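(* Fix $0<\eta<1/4$. There exist some $c>0$ in the model selection prior $\lambda_n(m)\propto\exp(-c\,d\,m\log(3m)\cdot\log n)$, $m\in\mathbb N$, and constants $C_1,C_2>0$, all depending only on $\eta$, such that if $n\ge d$ and $$\tau_{m,g}^{\mathrm{cvx}}\ge\exp\Big(-\frac{\log n\cdot\log(3m)}{8\eta}\Big),$$ then $$P_{f_0}^{(n)}\Pi_n\big(f\in\mathcal F:\ell_n^2(f,f_0)>C_1(\epsilon_{n,m}^{\mathrm{cvx}})^2\,\big|\,Y^{(n)}\big)\le C_2e^{-n(\epsilon_{n,m}^{\mathrm{cvx}})^2/C_2},$$ where $$(\epsilon_{n,m}^{\mathrm{cvx}})^2\equiv\max\Big\{\inf_{g\in\mathcal F_m}\ell_n^2(f_0,g),\ \frac{d\log n\cdot m\log(3m)}{n}\Big\}.$$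
   Context: Model: $Y_i=f_0(x_i)+\varepsilon_i$, $1\le i\le n$, with fixed design points $x_i\in[0,1]^d$ and $\varepsilon_i$ i.i.d. $\mathcal N(0,1)$, $Y^{(n)}=(Y_1,\dots,Y_n)$; $P_{f_0}^{(n)}$ is expectation under $f_0:[0,1]^d\to\mathbb R$. $\ell_n^2(f,g)=n^{-1}\sum_{i=1}^n(f(x_i)-g(x_i))^2$. $\mathcal F$ is the class of convex functions on $[0,1]^d$, and $\mathcal F_m=\{f(x)=\max_{1\le i\le m}(a_i\cdot x+b_i):a_i\in\mathbb R^d,b_i\in\mathbb R\}$. Prior: first draw $m$ from $\lambda_n$; given $m$, the prior on $\mathcal F_m$ is induced by the prior on $\{(a_i,b_i)\}_{i=1}^m\in(\mathbb R^d\times\mathbb R)^m$ with density $\bigotimes_{i=1}^m(g^{\otimes d}\otimes g)$, where $g$ is a probability density on $\mathbb R$, symmetric about $0$ and non-increasing on $(0,\infty)$. $\Pi_n(\cdot\mid Y^{(n)})$ is the resulting posterior. Any $f_{0,m}\in\arg\min_{h\in\mathcal F_m}\ell_n^2(f_0,h)$ is written $f_{0,m}(x)=\max_{1\le i\le m}(a_i^{(m)}\cdot x+b_i^{(m)})$, and $$\tau_{m,g}^{\mathrm{cvx}}=\sup_{f_{0,m}\in\arg\min_{h\in\mathcal F_m}\ell_n^2(f_0,h)}\ \min_{1\le i\le m}\big\{g(\|a_i^{(m)}\|_\infty+1),\,g(|b_i^{(m)}|+1)\big\}$$ (i.e. the minimum of all these $2m$ numbers). *)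

(* Defs.v *)
From HB Require Import structures.
From mathcomp Require Import all_boot all_order all_algebra.
From mathcomp Require Import all_classical all_reals all_analysis.

Set Implicit Arguments.
Unset Strict Implicit.
Unset Printing Implicit Defensive.

Import Order.TTheory GRing.Theory Num.Theory.
Import numFieldNormedType.Exports.

Local Open Scope classical_set_scope.
Local Open Scope ring_scope.

(* The library's \x carries its sigma-finite structure only for
   subprobabilities, so products of sigma-finite measures go through an
   alias. *)
Definition sigma_product d1 d2 (T1 : measurableType d1) (T2 : measurableType d2)
    (R : realType) (m1 : {sigma_finite_measure set T1 -> \bar R})
    (m2 : {sigma_finite_measure set T2 -> \bar R}) : set (T1 * T2) -> \bar R :=
  (m1 \x m2)%E.

Section sigma_product.
Context d1 d2 (T1 : measurableType d1) (T2 : measurableType d2) (R : realType).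
Variables (m1 : {sigma_finite_measure set T1 -> \bar R})
  (m2 : {sigma_finite_measure set T2 -> \bar R}).

HB.instance Definition _ := Measure.copy (sigma_product m1 m2) (m1 \x m2)%E.

Let sigma_product_sigma_finite : sigma_finite setT (sigma_product m1 m2).
Proof.
have /sigma_finiteP[F [TF ndF Foo]] := sigma_finiteT m1.
have /sigma_finiteP[G [TG ndG Goo]] := sigma_finiteT m2.
exists (fun k => F k `*` G k).
  rewrite -setXTT TF TG; apply/seteqP; split=> [[x y] /= [[k _ Fx] [l _ Gy]]|].
    exists (maxn k l) => //; split.
      by move: x Fx; exact/subsetPset/ndF/leq_maxl.
    by move: y Gy; exact/subsetPset/ndG/leq_maxr.
  by move=> [x y] [k _ [/= ? ?]]; split; exists k.
move=> k; have [? ?] := Foo k; have [? ?] := Goo k.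
split; first exact: measurableX.
by rewrite /sigma_product product_measure1E// lte_mul_pinfty// ge0_fin_numE.
Qed.

HB.instance Definition _ := Measure_isSigmaFinite.Build _ _ _
  (sigma_product m1 m2) sigma_product_sigma_finite.
End sigma_product.

(* n-fold powers of a sigma-finite measure, on n.-tuple T (whose
   sigma-algebra is generated by the coordinates): T^(n+1) carries the image
   of the product of T and T^n under (t, s) |-> t :: s. *)
Section measure_power.
Context d (T : measurableType d) (R : realType).

Definition tuple_cons n (p : T * n.-tuple T) : n.+1.-tuple T :=
  [the n.+1.-tuple T of p.1 :: p.2].

Lemma measurable_tuple_cons n : measurable_fun [set: T * n.-tuple T] (@tuple_cons n).
Proof. by apply: measurable_cons; [exact: measurable_fst|exact: measurable_snd]. Qed.

Definition cons_measure n (mu : {sigma_finite_measure set T -> \bar R})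
    (nu : {sigma_finite_measure set (n.-tuple T) -> \bar R}) :
    set (n.+1.-tuple T) -> \bar R :=
  pushforward (sigma_product mu nu) (@tuple_cons n).

Section instances.
Context n (mu : {sigma_finite_measure set T -> \bar R})
  (nu : {sigma_finite_measure set (n.-tuple T) -> \bar R}).

Let cons0 : cons_measure mu nu set0 = 0%E.
Proof. by rewrite /cons_measure /pushforward preimage_set0 measure0. Qed.

Let cons_ge0 A : (0 <= cons_measure mu nu A)%E.
Proof. by rewrite /cons_measure /pushforward integral_ge0. Qed.

Let cons_sigma_additive : semi_sigma_additive (cons_measure mu nu).
Proof.
move=> F mF tF mUF; rewrite /cons_measure /pushforward preimage_bigcup.
apply: measure_semi_sigma_additive.
- by move=> k; rewrite -[X in measurable X]setTI; exact: measurable_tuple_cons.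
- apply/trivIsetP => /= i j _ _ ij; rewrite -preimage_setI.
  by move/trivIsetP : tF => /(_ _ _ _ _ ij) ->//; rewrite preimage_set0.
- by rewrite -preimage_bigcup -[X in measurable X]setTI; exact: measurable_tuple_cons.
Qed.

HB.instance Definition _ := isMeasure.Build _ _ _ (cons_measure mu nu)
  cons0 cons_ge0 cons_sigma_additive.

Let cons_sigma_finite : sigma_finite setT (cons_measure mu nu).
Proof.
have [F FT mF] := sigma_finiteT (sigma_product mu nu).
pose uncons (t : n.+1.-tuple T) := (thead t, [tuple of behead t]).
have consK : cancel (@tuple_cons n) uncons.
  by case=> t s; congr pair; apply/val_inj.
have munc : measurable_fun setT uncons.
  apply: measurable_fun_pair; first exact: measurable_tnth.
  exact: measurable_behead.
exists (fun k => uncons @^-1` F k).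
  by rewrite -preimage_bigcup -FT preimage_setT.
move=> k; have [mFk Fk] := mF k; split.
  by rewrite -[X in measurable X]setTI; exact: munc.
rewrite /cons_measure /pushforward.
rewrite (_ : _ @^-1` _ = F k)//; apply/seteqP.
by split => p /=; rewrite consK.
Qed.

HB.instance Definition _ := Measure_isSigmaFinite.Build _ _ _
  (cons_measure mu nu) cons_sigma_finite.
End instances.

Fixpoint measure_power (mu : {sigma_finite_measure set T -> \bar R}) n :
    {sigma_finite_measure set (n.-tuple T) -> \bar R} :=
  match n with
  | 0 => \d_([tuple] : 0.-tuple T)
  | k.+1 => cons_measure mu (measure_power mu k)
  end.

End measure_power.

Section convex_regression.
Context (R : realType).

Section functions.
Context (d : nat).

Definition cube : set 'rV[R]_d := [set x | forall j, 0 <= x 0 j <= 1].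

(* Functions on [0,1]^d are total functions on R^d; only their values on the
   cube are ever used. *)
Definition convex_class : set ('rV[R]_d -> R) := [set f | convex_function cube f].

(* The pair (a, b) codes the affine function x |-> a . x + b. *)
Definition affine (p : d.-tuple R * R) (x : 'rV[R]_d) : R :=
  \sum_(j < d) tnth p.1 j * x 0 j + p.2.

(* The start value of the maximum is the first term, so for 0 < m this is
   the maximum over the m affine functions. *)
Definition max_affine m (theta : m.-tuple (d.-tuple R * R)) (x : 'rV[R]_d) : R :=
  \big[Num.max/affine (head ([tuple of nseq d 0], 0) theta) x]_(i < m)
    affine (tnth theta i) x.

Definition max_affine_class m : set ('rV[R]_d -> R) := range (@max_affine m).

Context (n : nat) (x : 'I_n -> 'rV[R]_d).

Definition ell2 (f g : 'rV[R]_d -> R) : R :=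
  n%:R^-1 * \sum_(i < n) (f (x i) - g (x i)) ^+ 2.

Definition argmin_class m (f0 : 'rV[R]_d -> R) : set ('rV[R]_d -> R) :=
  [set h | max_affine_class m h /\
           forall h', max_affine_class m h' -> ell2 f0 h <= ell2 f0 h'].

Definition sup_norm (a : d.-tuple R) : R := \big[Num.max/0]_(j < d) `|tnth a j|.

(* The supremum runs over all parameters of all minimizers, as a minimizer
   may have several representations. *)
Definition tau_cvx m (g : R -> R) (f0 : 'rV[R]_d -> R) : \bar R :=
  ereal_sup [set \big[mine/+oo%E]_(i < m)
                   mine (g (sup_norm (tnth theta i).1 + 1))%:E
                        (g (`|(tnth theta i).2| + 1))%:E
            | theta in [set theta : m.-tuple (d.-tuple R * R) |
                         argmin_class m f0 (max_affine theta)]].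

Definition eps2_cvx m (f0 : 'rV[R]_d -> R) : R :=
  Num.max (inf [set ell2 f0 h | h in max_affine_class m])
          (d%:R * ln n%:R * (m%:R * ln (3 * m)%:R) / n%:R).

(* Expectation of F(Y) for Y_i = f0(x_i) + e_i, e_i i.i.d. N(0,1). *)
Definition expect_under (f0 : 'rV[R]_d -> R) (F : n.-tuple R -> R) : \bar R :=
  \int[measure_power (normal_prob (0 : R) 1) n]_e
    (F [tuple f0 (x i) + tnth e i | i < n])%:E.

Definition likelihood (y : n.-tuple R) (f : 'rV[R]_d -> R) : R :=
  \prod_(i < n) normal_pdf (f (x i)) 1 (tnth y i).

End functions.

Definition prior_density (g : R -> R) : Prop :=
  [/\ measurable_fun setT g,
      (forall t, 0 <= g t),
      (\int[lebesgue_measure]_t (g t)%:E = 1)%E,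
      (forall t, g (- t) = g t) &
      (forall s t, 0 < s -> s <= t -> g t <= g s)].

(* Probability mass functions on {1, 2, ...} proportional to
   exp(- c d m log(3m) log n); for n = 1 there is none. *)
Definition selection_prior (c : R) (d n : nat) (lam : nat -> R) : Prop :=
  (exists2 K : R, 0 < K &
     forall m, (0 < m)%N ->
       lam m = K * expR (- (c * d%:R * m%:R * ln (3 * m)%:R * ln n%:R))) /\
  (\sum_(1 <= m <oo) (lam m)%:E = 1)%E.

Section posterior.
Context (d : nat).

Definition param_density (g : R -> R) m (theta : m.-tuple (d.-tuple R * R)) : R :=
  \prod_(i < m) ((\prod_(j < d) g (tnth (tnth theta i).1 j)) * g (tnth theta i).2).

Definition param_lebesgue m : set (m.-tuple (d.-tuple R * R)) -> \bar R :=
  measure_power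
    (sigma_product (measure_power (@lebesgue_measure R) d) (@lebesgue_measure R)) m.

(* The integral of L over A against the prior: m is drawn from lam, and given
   m the function is max_affine theta with theta of density param_density. *)
Definition prior_integral (g : R -> R) (lam : nat -> R)
    (A : set ('rV[R]_d -> R)) (L : ('rV[R]_d -> R) -> R) : \bar R :=
  (\sum_(1 <= m <oo) (lam m)%:E *
     \int[@param_lebesgue m]_(theta in @max_affine d m @^-1` A)
        (L (max_affine theta) * param_density g theta)%:E)%E.

Definition posterior n (x : 'I_n -> 'rV[R]_d) (g : R -> R) (lam : nat -> R)
    (A : set ('rV[R]_d -> R)) (y : n.-tuple R) : R :=
  fine (prior_integral g lam A (likelihood x y)) /
  fine (prior_integral g lam setT (likelihood x y)).

End posterior.

End convex_regression.

(* Main.v *)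
From HB Require Import structures.
Require Import Defs.
From mathcomp Require Import all_boot all_order all_algebra.
From mathcomp Require Import all_classical all_reals all_analysis.
From mathcomp Require Import measurable_realfun ring lra zify.

(** Why the theorem is true.  Write f for a function and h for the vector of
    its deviations f(x_i) - f_0(x_i); let e be the noise.  The likelihood
    ratio of f against f_0 is exp(<e,h> - |h|^2/2) ([likelihood_ratio]), and
    the posterior is a quotient of two integrals of it, so everything rests
    on controlling <e,h> simultaneously over all max-affine f.

    The values of a k-piece max-affine function at the design points are
    affine on each of k groups of points, so they lie in a linear space of
    dimension at most k(d+1) determined by the grouping.  The grouping depends
    only on the signs of n k^2 linear forms in the k(d+1) parameters, and N
    linear forms on a D-dimensional space have at most (N+1)^D sign patterns
    ([card_sign_patterns]).  Hence h always lies in one of at most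
    (n k^2 + 1)^(k(d+1)) spaces W ([residual_cover]).  For h in W,
    |<e,h>| <= |h|^2/4 + |P_W e|^2, where |P_W e|^2 is chi-squared, so
    exp(|P_W e|^2/4) has mean 2^(dim W/2) ([noise_projection_tail_mgf]).  With
    D_k = d log n * k log(3k) and E = n eps^2, a union bound over k and W shows
    that |P_W e|^2 <= 104 D_k + 4 E for all k and W, up to probability
    exp(-E) ([integral_exceedance]).  This replaces tests and entropy bounds.

    On that event the likelihood ratio is at most
    exp(-|h|^2/4 + 104 D_k + 4 E).  The model prior exp(-108 D_k) absorbs the
    D_k term and is summable, so the numerator over |h|^2 > C_1 E is at most
    exp((4 - C_1/4) E) ([prior_integral_far]).  The same event also bounds the
    likelihood ratio below by exp(-134 E) on a box of side n^-2 next to the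
    coefficients of a minimizer; the hypothesis on tau and the monotonicity of
    g make the prior mass of the box at least exp(-C(eta) E)
    ([prior_integral_lower]).  The normalizing constant of the model prior
    and the likelihood of f_0 cancel in the quotient, and C_1 = 1036 + 1/eta
    leaves exp(-E).

    The posterior need not be measurable in the data: it is dominated
    pointwise by [exceedance] plus exp(-E), and the integral of a nonnegative
    function is monotone without measurability of the smaller function. *)

Set Implicit Arguments.
Unset Strict Implicit.
Unset Printing Implicit Defensive.

Import Order.TTheory GRing.Theory Num.Theory.
Import numFieldNormedType.Exports.

Local Open Scope classical_set_scope.
Local Open Scope ring_scope.

(** * Integration against products and the normal distribution *)

Section monotone.
Context d (T : measurableType d) (R : realType) (mu : {measure set T -> \bar R}).
Local Open Scope ereal_scope.
Import HBNNSimple.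

(** The integral of a nonnegative function is a supremum over the simple
    functions below it, so it is monotone whether or not the functions are
    measurable. *)
Lemma ge0_le_integral_nonmeasurable (D : set T) (f g : T -> \bar R) :
  (forall x, D x -> 0 <= f x) -> (forall x, 0 <= g x) -> (forall x, D x -> f x <= g x) ->
  \int[mu]_(x in D) f x <= \int[mu]_x g x.
Proof.
move=> f0 g0 fg; rewrite integral_mkcond !ge0_integralTE//; last first.
  by move=> x; apply: erestrict_ge0.
apply: ereal_sup_le => _ [h /= hf <-].
exists h => //= x.
apply: le_trans (hf x) _; rewrite patchE; case: ifPn => // /set_mem; exact: fg.
Qed.
End monotone.

Section density.
Context (R : realType) (m s : R).
Local Open Scope ereal_scope.
Import HBNNSimple.
Notation mu := lebesgue_measure.
Let p x : \bar R := (normal_pdf m s x)%:E.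
Let p0 x : 0 <= p x. Proof. by rewrite lee_fin normal_pdf_ge0. Qed.
Let mp : measurable_fun [set: measurableTypeR R] p.
Proof. apply/measurable_EFinP; exact: measurable_normal_pdf. Qed.

Let nnsfun_case (f : {nnsfun _ >-> R}) :
  \int[normal_prob m s]_x (f x)%:E = \int[mu]_x ((f x)%:E * p x).
Proof.
under [LHS]eq_integral do rewrite fimfunE -fsumEFin//.
rewrite [LHS]ge0_integral_fsum//; last 2 first.
  - by move=> r; exact/measurable_EFinP/measurableT_comp.
  - by move=> n x _; rewrite EFinM nnfun_muleindic_ge0.
under [RHS]eq_integral.
  move=> x xD; rewrite fimfunE -fsumEFin// muleC ge0_mule_fsumr; last first.
    by move=> r; rewrite EFinM nnfun_muleindic_ge0.
  over.
rewrite [RHS]ge0_integral_fsum//; last 2 first.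
  - move=> r; apply: emeasurable_funM => //.
    by apply/measurable_EFinP; exact: measurableT_comp.
  - by move=> n x _; rewrite EFinM mule_ge0// nnfun_muleindic_ge0.
apply: eq_fsbigr => r _.
rewrite integralZl_indic_nnsfun//= integral_indic// setIT.
under eq_integral => x _ do rewrite EFinM muleCA -[p x * _]muleC.
have [r0|r0] := leP 0%R r; last first.
  have -> : f @^-1` [set r] = set0.
    by apply/seteqP; split => // x /= fx; move: r0; rewrite -fx ltNge fun_ge0.
  rewrite measure0 mule0; under eq_integral do rewrite indic0 mul0e mule0.
  by rewrite integral0.
rewrite ge0_integralZl//; last 2 first.
- apply: emeasurable_funM => //; exact/measurable_EFinP/measurable_indic.
- by move=> x _; rewrite mule_ge0.
congr (_ * _); transitivity (\int[mu]_(x in f @^-1` [set r]) p x) => //.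
rewrite [LHS]integral_mkcond; apply: eq_integral => x _.
by rewrite patchE indicE; case: ifPn; rewrite ?mul1e ?mul0e.
Qed.

(** [normal_prob] is defined through its density on sets only; the change of
    measure for functions follows by monotone approximation by simple
    functions. *)
Lemma integral_normal_prob (f : measurableTypeR R -> \bar R) :
  measurable_fun setT f -> (forall x, 0 <= f x) ->
  \int[normal_prob m s]_x f x = \int[mu]_x (f x * (normal_pdf m s x)%:E).
Proof.
move=> mf f0.
pose f_ := nnsfun_approx measurableT mf.
transitivity (lim (\int[normal_prob m s]_x (f_ n x)%:E @[n --> \oo])).
  rewrite -monotone_convergence//=.
  - apply: eq_integral => ? /[!inE] xD; apply/esym/cvg_lim => //=.
    exact: cvg_nnsfun_approx.
  - by move=> n; exact/measurable_EFinP/measurable_funTS.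
  - by move=> n ? _; rewrite lee_fin.
  - by move=> ? _ ? ? mn; rewrite lee_fin; exact/lefP/nd_nnsfun_approx.
under eq_fun do rewrite nnsfun_case.
rewrite -monotone_convergence//=.
- apply: eq_integral => x _; apply/cvg_lim => //=.
  apply: cvgeZr => //; exact: cvg_nnsfun_approx.
- move=> n; apply: emeasurable_funM => //.
  by apply/measurable_EFinP; exact: measurable_funP.
- by move=> n x _; rewrite mule_ge0// lee_fin.
- move=> x _ a b ab; apply: lee_wpmul2r => //.
  by rewrite lee_fin; exact/lefP/nd_nnsfun_approx.
Qed.

End density.

Section product_integrals.
Context (R : realType).
Local Open Scope ereal_scope.

Lemma integral_sigma_product d1 d2 (T1 : measurableType d1) (T2 : measurableType d2)
    (m1 : {sigma_finite_measure set T1 -> \bar R})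
    (m2 : {sigma_finite_measure set T2 -> \bar R}) (f : T1 * T2 -> \bar R) :
  measurable_fun setT f -> (forall x, 0 <= f x) ->
  \int[sigma_product m1 m2]_z f z = \int[m1]_x \int[m2]_y f (x, y).
Proof.
by move=> mf f0; rewrite /sigma_product; have := @fubini_tonelli1 _ _ T1 T2 R m1 m2 f mf f0.
Qed.

Lemma integral_sigma_product_mul d1 d2 (T1 : measurableType d1)
    (T2 : measurableType d2) (m1 : {sigma_finite_measure set T1 -> \bar R})
    (m2 : {sigma_finite_measure set T2 -> \bar R})
    (f : T1 -> R) (g : T2 -> R) (a b : R) :
  measurable_fun setT f -> (forall x, 0 <= f x)%R ->
  measurable_fun setT g -> (forall x, 0 <= g x)%R ->
  \int[m1]_x (f x)%:E = a%:E -> \int[m2]_x (g x)%:E = b%:E ->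
  \int[sigma_product m1 m2]_z (f z.1 * g z.2)%:E = (a * b)%:E.
Proof.
move=> mf f0 mg g0 fa gb.
rewrite integral_sigma_product/=; last 2 first.
- apply/measurable_EFinP; apply: measurable_funM; exact: measurableT_comp.
- by move=> x; rewrite lee_fin mulr_ge0.
have b0 : (0 <= b)%R.
  by rewrite -lee_fin -gb; apply: integral_ge0 => x _; rewrite lee_fin.
transitivity (\int[m1]_x (b%:E * (f x)%:E)); last first.
  rewrite ge0_integralZl//; last 2 first.
  - exact/measurable_EFinP.
  - by move=> x _; rewrite lee_fin.
  by rewrite fa muleC EFinM.
apply: eq_integral => x _; rewrite -gb muleC -ge0_integralZl//.
- exact/measurable_EFinP.
- by move=> y _; rewrite lee_fin.
- by rewrite lee_fin.
Qed.

Context d (T : measurableType d) (mu : {sigma_finite_measure set T -> \bar R}).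

Lemma integral_measure_powerS n (f : n.+1.-tuple T -> \bar R) :
  measurable_fun setT f -> (forall t, 0 <= f t) ->
  \int[measure_power mu n.+1]_t f t =
  \int[sigma_product mu (measure_power mu n)]_z f (tuple_cons z).
Proof.
move=> mf f0 /=.
exact: (ge0_integral_pushforward (measurable_tuple_cons (n:=n))).
Qed.

(** All integrals over powers that occur below (boxes, densities, exponentials
    of linear forms) are of this product form with finite factors; stating the
    factors as reals avoids products of extended reals. *)
Lemma integral_measure_power_prod n (F : 'I_n -> T -> R) (c : 'I_n -> R) :
  (forall i, measurable_fun setT (F i)) -> (forall i t, 0 <= F i t)%R ->
  (forall i, \int[mu]_t (F i t)%:E = (c i)%:E) ->
  \int[measure_power mu n]_t (\prod_(i < n) F i (tnth t i))%:E =
  (\prod_(i < n) c i)%:E.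
Proof.
elim: n F c => [|n IHn] F c mF F0 Fc.
  rewrite big_ord0 /=; under eq_integral do rewrite big_ord0.
  by rewrite integral_cst// mul1e; exact: diracT.
rewrite integral_measure_powerS; last 2 first.
- apply/measurable_EFinP; apply: measurable_prod => i _.
  by apply: measurableT_comp => //; exact: measurable_tnth.
- by move=> t; rewrite lee_fin prodr_ge0.
rewrite big_ord_recl -(@integral_sigma_product_mul _ _ _ _ mu (measure_power mu n)
  (F ord0) (fun t : n.-tuple T => \prod_(i < n) F (lift ord0 i) (tnth t i))%R) //.
- apply: eq_integral => -[t s] _ /=; rewrite big_ord_recl.
  congr (_ * _)%:E; apply: eq_bigr => i _; congr (F _ _).
  by rewrite [RHS](tnth_nth t) (tnth_nth t).
- apply: measurable_prod => i _.
  by apply: measurableT_comp => //; exact: measurable_tnth.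
- by move=> s; apply: prodr_ge0.
- exact: (IHn (fun i => F (lift ord0 i)) (fun i => c (lift ord0 i))).
Qed.

End product_integrals.

Section parameter_integral.
Context (R : realType).
Local Open Scope ereal_scope.
Notation leb := (@lebesgue_measure R).

Context (d m : nat).
(* [lebesgue_measure] lives on [measurableTypeR R], whereas integrals over
   tuples of type [R] use the structure of [R] itself.  The two sigma-algebras
   coincide but their displays do not, so the identity [retype] transports
   one to the other. *)
Let RT : measurableType _ := measurableTypeR R.
Let piece : measurableType _ := (d.-tuple RT * RT)%type.
Let params : measurableType _ := (m.-tuple piece).

Let piece_measure : {sigma_finite_measure set piece -> \bar R} :=
  sigma_product (measure_power leb d) leb.

Let params_measure : {sigma_finite_measure set params -> \bar R} :=
  measure_power piece_measure m.

Let retype (theta : params) : m.-tuple (d.-tuple R * R) := theta.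

Let measurable_retype : measurable_fun setT retype.
Proof. by move=> _ A mA; rewrite setTI; exact: mA. Qed.

Let params_measureE : @param_lebesgue R d m = pushforward params_measure retype.
Proof. by []. Qed.

Lemma ge0_le_integral_param (D : set (m.-tuple (d.-tuple R * R)))
    (f g : m.-tuple (d.-tuple R * R) -> \bar R) :
  (forall x, D x -> 0 <= f x) -> (forall x, 0 <= g x) ->
  (forall x, D x -> f x <= g x) ->
  \int[@param_lebesgue R d m]_(x in D) f x <= \int[@param_lebesgue R d m]_x g x.
Proof.
rewrite params_measureE.
pose mfphi := isMeasurableFun.Build _ _ _ _ _ measurable_retype.
pose phi : {mfun _ >-> _} := HB.pack retype mfphi.
exact: (@ge0_le_integral_nonmeasurable _ _ R (pushforward params_measure phi)).
Qed.

Lemma integral_param_ge0 (D : set (m.-tuple (d.-tuple R * R)))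
    (f : m.-tuple (d.-tuple R * R) -> \bar R) :
  (forall x, D x -> 0 <= f x) -> 0 <= \int[@param_lebesgue R d m]_(x in D) f x.
Proof.
rewrite params_measureE.
pose mfphi := isMeasurableFun.Build _ _ _ _ _ measurable_retype.
pose phi : {mfun _ >-> _} := HB.pack retype mfphi.
exact: (@integral_ge0 _ _ R (pushforward params_measure phi)).
Qed.

Lemma integral_param_prod (k : R) (F : 'I_m -> 'I_d -> measurableTypeR R -> R)
    (G : 'I_m -> measurableTypeR R -> R) (a : 'I_m -> 'I_d -> R) (b : 'I_m -> R) :
  (0 <= k)%R -> (forall i j, measurable_fun setT (F i j)) -> (forall i j t, 0 <= F i j t)%R ->
  (forall i, measurable_fun setT (G i)) -> (forall i t, 0 <= G i t)%R ->
  (forall i j, \int[leb]_t (F i j t)%:E = (a i j)%:E) ->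
  (forall i, \int[leb]_t (G i t)%:E = (b i)%:E) ->
  \int[@param_lebesgue R d m]_theta
     (k * \prod_(i < m) ((\prod_(j < d) F i j (tnth (tnth theta i).1 j)) *
                         G i (tnth theta i).2))%:E =
  (k * \prod_(i < m) ((\prod_(j < d) a i j) * b i))%:E.
Proof.
move=> k0 mF F0 mG G0 Fa Gb.
have mprod i : measurable_fun [set: d.-tuple RT]
    (fun u => \prod_(j < d) F i j (tnth u j))%R.
  apply: measurable_prod => j _.
  by apply: measurableT_comp => //; exact: measurable_tnth.
have mpiece i : measurable_fun [set: piece]
    (fun p => (\prod_(j < d) F i j (tnth p.1 j)) * G i p.2)%R.
  apply: measurable_funM; last exact: measurableT_comp.
  exact: (measurableT_comp (mprod i)).
pose Phi (theta : params) : R := (\prod_(i < m)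
  ((\prod_(j < d) F i j (tnth (tnth theta i).1 j)) * G i (tnth theta i).2))%R.
have mPhi : measurable_fun setT Phi.
  apply: measurable_prod => i _.
  apply: (measurableT_comp (mpiece i)); exact: measurable_tnth.
have Phi0 theta : (0 <= Phi theta)%R.
  by rewrite prodr_ge0// => i _; rewrite mulr_ge0// prodr_ge0.
rewrite params_measureE (ge0_integral_pushforward measurable_retype)//; last 2 first.
- suff : measurable_fun [set: params] (fun theta => (k * Phi theta)%:E) by [].
  by apply/measurable_EFinP; exact: measurable_funM.
- by move=> theta _; rewrite lee_fin mulr_ge0// Phi0.
transitivity (\int[params_measure]_theta (k%:E * (Phi theta)%:E)) => //.
rewrite ge0_integralZl//; last 2 first.
- exact/measurable_EFinP.
- by move=> theta _; rewrite lee_fin.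
rewrite EFinM; congr (_ * _).
apply: (@integral_measure_power_prod R _ _ piece_measure m
  (fun i p => (\prod_(j < d) F i j (tnth p.1 j)) * G i p.2)%R
  (fun i => (\prod_(j < d) a i j) * b i)%R).
- exact: mpiece.
- by move=> i t; rewrite mulr_ge0// prodr_ge0.
- move=> i.
apply: (@integral_sigma_product_mul _ _ _ _ _ _ leb (fun u =>
    \prod_(j < d) F i j (tnth u j))%R (G i)) => //.
  + by move=> u; rewrite prodr_ge0.
  + exact: integral_measure_power_prod.
Qed.

End parameter_integral.

(** * Gaussian noise and orthogonal projections *)

Section dot_product.
Context (R : realType) (n : nat).
Implicit Types (u v w : 'rV[R]_n) (us : seq 'rV[R]_n).

Definition dot u v : R := \sum_(i < n) u 0 i * v 0 i.

Lemma dotC u v : dot u v = dot v u.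
Proof. by apply: eq_bigr => i _; rewrite mulrC. Qed.

Lemma dotDl u v w : dot (u + v) w = dot u w + dot v w.
Proof. by rewrite -big_split; apply: eq_bigr => i _; rewrite mxE mulrDl. Qed.

Lemma dotZl a u v : dot (a *: u) v = a * dot u v.
Proof. by rewrite mulr_sumr; apply: eq_bigr => i _; rewrite mxE mulrA. Qed.

Lemma dotDr u v w : dot w (u + v) = dot w u + dot w v.
Proof. by rewrite dotC dotDl !(dotC w). Qed.

Lemma dotZr a u v : dot v (a *: u) = a * dot v u.
Proof. by rewrite dotC dotZl dotC. Qed.

Lemma dot0l u : dot 0 u = 0.
Proof. by rewrite -(scale0r 0) dotZl mul0r. Qed.

Lemma dotNl u v : dot (- u) v = - dot u v.
Proof. by rewrite -scaleN1r dotZl mulN1r. Qed.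

Lemma dotNr u v : dot v (- u) = - dot v u.
Proof. by rewrite dotC dotNl dotC. Qed.

Lemma dot_sumr I (r : seq I) (F : I -> 'rV[R]_n) v :
  dot v (\sum_(i <- r) F i) = \sum_(i <- r) dot v (F i).
Proof.
elim: r => [|i r IHr]; first by rewrite !big_nil dotC dot0l.
by rewrite !big_cons dotDr IHr.
Qed.

Lemma dot_ge0 u : 0 <= dot u u.
Proof. by rewrite sumr_ge0// => i _; rewrite -expr2 sqr_ge0. Qed.

Lemma dot_eq0 u : dot u u = 0 -> u = 0.
Proof.
move=> /eqP; rewrite psumr_eq0 => [/allP u0|i _]; last by rewrite -expr2 sqr_ge0.
apply/rowP => i; rewrite mxE; apply/eqP; rewrite -sqrf_eq0 expr2.
exact: u0 (mem_index_enum _).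
Qed.

Definition orthonormal_seq us : bool :=
  pairwise (fun u v => dot u v == 0) us && all (fun u => dot u u == 1) us.

Lemma orthonormal_seq_cons u us : orthonormal_seq (u :: us) =
  [&& dot u u == 1, all (fun v => dot u v == 0) us & orthonormal_seq us].
Proof. by rewrite /orthonormal_seq /= andbACA [X in X && _]andbC -andbA. Qed.

(** For orthonormal [us], the squared norm of the orthogonal projection onto
    their span. *)
Definition proj_sq us v : R := \sum_(u <- us) dot v u ^+ 2.

End dot_product.

Section gaussian.
Context (R : realType).
Local Open Scope ereal_scope.
Notation gauss := (normal_prob (0 : R) 1).

(** Completing the square: the integrand times the standard normal density is
    a multiple of the normal density of mean [b s^2] and deviation [s]. *)
Lemma integral_gauss_quadratic (b s : R) : (0 < s)%R ->
  \int[gauss]_z (expR (b * z + (1 - (s ^+ 2)^-1) / 2 * z ^+ 2))%:E =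
  (s * expR (b ^+ 2 * s ^+ 2 / 2))%:E.
Proof.
move=> s0; rewrite integral_normal_prob; last 2 first.
- apply/measurable_EFinP; apply: measurableT_comp => //.
  apply: measurable_funD; first exact: measurable_funM.
  by apply: measurable_funM => //; exact: measurable_funX.
- by move=> z; rewrite lee_fin expR_ge0.
have key (p A N1 B N2 : R) : (A + N1 = B + N2 ->
    expR A * (s * p * expR N1) = s * expR B * (p * expR N2))%R.
  move=> E; transitivity (s * p * expR (A + N1))%R; first by rewrite expRD; ring.
  by rewrite E expRD; ring.
transitivity (\int[lebesgue_measure]_z
  ((s * expR (b ^+ 2 * s ^+ 2 / 2))%:E * (normal_pdf (b * s ^+ 2) s z)%:E)).
  apply: eq_integral => z _; rewrite -!EFinM !normal_pdfE ?gt_eqF//; congr _%:E.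
  have -> : normal_peak 1 = (s * normal_peak s)%R.
    rewrite /normal_peak expr1n mul1r -[(s ^+ 2 * pi *+ 2)%R]mulrnAr.
    rewrite sqrtrM ?sqr_ge0// sqrtr_sqr gtr0_norm// invfM mulrA divff ?mul1r//.
    by rewrite gt_eqF.
  by apply: key; field; rewrite gt_eqF.
rewrite ge0_integralZl//.
- by rewrite integral_normal_pdf mule1.
- by apply/measurable_EFinP; exact: measurable_normal_pdf.
- by move=> z _; rewrite lee_fin normal_pdf_ge0.
- by rewrite lee_fin mulr_ge0 ?ltW ?expR_gt0.
Qed.

Context (n : nat).
Notation noise := (measure_power gauss n).

Definition noise_vec (e : n.-tuple R) : 'rV[R]_n := \row_i tnth e i.

Lemma measurable_dot_noise (v : 'rV[R]_n) :
  measurable_fun [set: n.-tuple (measurableTypeR R)] (fun e => dot (noise_vec e) v).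
Proof.
rewrite /dot; apply: measurable_sum => i.
under eq_fun do rewrite mxE.
by apply: measurable_funM => //; exact: measurable_tnth.
Qed.

Lemma noise_mgf (v : 'rV[R]_n) :
  \int[noise]_e (expR (dot (noise_vec e) v))%:E = (expR (dot v v / 2))%:E.
Proof.
have -> : expR (dot v v / 2) = (\prod_(i < n) expR (v 0%R i ^+ 2 / 2))%R.
  by rewrite -expR_sum -mulr_suml.
rewrite -(@integral_measure_power_prod _ _ _ gauss n
  (fun i z => expR (v 0%R i * z))%R).
- apply: eq_integral => e _; rewrite -expR_sum /dot; congr (expR _)%:E.
  by apply: eq_bigr => i _; rewrite mxE mulrC.
- by move=> i; apply: measurableT_comp => //; exact: measurable_funM.
- by move=> i z; rewrite expR_ge0.
- move=> i; have := integral_gauss_quadratic (v 0%R i) (@ltr01 R).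
  rewrite expr1n invr1 subrr !mul0r mul1r mulr1 => <-.
  by apply: eq_integral => z _; rewrite mul0r addr0.
Qed.

End gaussian.

Section projection.
Context (R : realType) (n : nat).
Local Open Scope ereal_scope.
Notation gauss := (normal_prob (0 : R) 1).
Notation noise := (measure_power gauss n).
Notation sqrt2 := (Num.sqrt (2 : R)).

Lemma measurable_proj_sq_noise (us : seq 'rV[R]_n) :
  measurable_fun [set: n.-tuple (measurableTypeR R)]
    (fun e => proj_sq us (noise_vec e)).
Proof.
apply: measurable_sum => u; apply: measurable_funX; exact: measurable_dot_noise.
Qed.

(** Rather than rotating coordinates, linearize the square: exp(a^2/4) is the
    mean of exp(z a / sqrt 2) over a standard normal z.  Exchanging the
    integrals turns each direction of [us] into a shift of the linear term
    [v], which is why [v] is carried through the induction. *)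
Lemma noise_projection_mgf (us : seq 'rV[R]_n) (v : 'rV[R]_n) : orthonormal_seq us ->
  \int[noise]_e (expR (dot (noise_vec e) v + proj_sq us (noise_vec e) / 4))%:E =
  (sqrt2 ^+ size us * expR (dot v v / 2 + proj_sq us v / 2))%:E.
Proof.
elim: us v => [|u us IHus] v.
  move=> _; rewrite /proj_sq expr0 mul1r.
  under eq_integral do rewrite big_nil mul0r addr0.
  by rewrite big_nil mul0r addr0 noise_mgf.
rewrite orthonormal_seq_cons => /and3P[/eqP uu /allP uus ous].
have s20 : (0 < sqrt2)%R by rewrite sqrtr_gt0.
have s2E : (sqrt2 ^+ 2 = 2)%R by rewrite sqr_sqrtr.
pose w (z : R) : 'rV[R]_n := (v + (z / sqrt2) *: u)%R.
pose h (e : n.-tuple (measurableTypeR R)) (z : measurableTypeR R) :=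
  (expR (dot (noise_vec e) (w z) + proj_sq us (noise_vec e) / 4))%:E.
have mh : measurable_fun setT (fun p => h p.1 p.2).
  apply/measurable_EFinP; apply: measurableT_comp => //.
  apply: measurable_funD; last first.
    apply: measurable_funM => //.
    by apply: (measurableT_comp (measurable_proj_sq_noise us)).
  under eq_fun do rewrite dotDr dotZr.
  apply: measurable_funD.
    by apply: (measurableT_comp (measurable_dot_noise v)).
  apply: measurable_funM; first exact: measurable_funM.
  by apply: (measurableT_comp (measurable_dot_noise u)).
have h0 p : 0 <= h p.1 p.2 by rewrite lee_fin expR_ge0.
transitivity (\int[noise]_e \int[gauss]_z h e z).
  apply: eq_integral => e _.
  transitivity (\int[gauss]_z
    ((expR (dot (noise_vec e) v + proj_sq us (noise_vec e) / 4))%:E *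
     (expR (dot (noise_vec e) u / sqrt2 * z +
        (1 - (1 ^+ 2)^-1) / 2 * z ^+ 2))%:E)).
    rewrite ge0_integralZl//; last first.
    - apply/measurable_EFinP; apply: measurableT_comp => //.
      apply: measurable_funD; first exact: measurable_funM.
      by apply: measurable_funM => //; exact: measurable_funX.
    rewrite integral_gauss_quadratic// -EFinM mul1r -expRD /proj_sq big_cons.
    by congr (expR _)%:E; rewrite expr_div_n s2E expr1n; field.
  apply: eq_integral => z _; rewrite -EFinM -expRD; congr (expR _)%:E.
  by rewrite /w dotDr dotZr expr1n invr1 subrr !mul0r addr0; ring.
(* Integrate the noise first, with the shifted linear term [w z]. *)
rewrite (fubini_tonelli (m1 := noise) (m2 := gauss) _ mh)//.
have dotw z : dot (w z) (w z) = (dot v v + 2 * (z / sqrt2) * dot v u + z ^+ 2 / 2)%R.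
  have <- : ((z / sqrt2) ^+ 2 = z ^+ 2 / 2)%R by rewrite expr_div_n s2E.
  by rewrite /w dotDl !dotDr !dotZl !dotZr uu (dotC u v); ring.
have projw z : proj_sq us (w z) = proj_sq us v.
  apply: eq_big_seq => u' /uus /eqP uu'.
  by rewrite /w dotDl dotZl uu' mulr0 addr0.
transitivity (\int[gauss]_z
  ((sqrt2 ^+ size us * expR (dot v v / 2 + proj_sq us v / 2))%:E *
   (expR (dot v u / sqrt2 * z + (1 - (sqrt2 ^+ 2)^-1) / 2 * z ^+ 2))%:E)).
  apply: eq_integral => z _.
  transitivity (sqrt2 ^+ size us * expR (dot (w z) (w z) / 2 + proj_sq us (w z) / 2))%:E.
    by rewrite -(IHus (w z) ous); apply: eq_integral.
  rewrite -EFinM; congr _%:E; rewrite -[RHS]mulrA -expRD.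
  by congr (_ * expR _)%R; rewrite projw dotw s2E; field; rewrite gt_eqF.
rewrite ge0_integralZl//; last first.
- apply/measurable_EFinP; apply: measurableT_comp => //.
  apply: measurable_funD; first exact: measurable_funM.
  by apply: measurable_funM => //; exact: measurable_funX.
rewrite integral_gauss_quadratic// -EFinM /=; congr _%:E.
rewrite mulrACA -expRD -exprSr; congr (_ * expR _)%R.
by rewrite /proj_sq big_cons expr_div_n s2E; field.
Qed.

Lemma noise_projection_tail_mgf (us : seq 'rV[R]_n) : orthonormal_seq us ->
  \int[noise]_e (expR (proj_sq us (noise_vec e) / 4))%:E = (sqrt2 ^+ size us)%:E.
Proof.
move=> ous; have := noise_projection_mgf 0 ous.
rewrite dot0l [proj_sq us 0]big1 => [|u _]; last by rewrite dot0l expr0n.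
rewrite !mul0r addr0 expR0 mulr1 => <-.
by apply: eq_integral => e _; rewrite dotC dot0l add0r.
Qed.

End projection.

(** * Orthonormal families *)

Section gram_schmidt.
Context (R : realType) (n : nat).
Implicit Types (u v w h e : 'rV[R]_n) (us ws : seq 'rV[R]_n).

Lemma orthonormal_comb us (c : 'rV[R]_n -> R) u : orthonormal_seq us -> u \in us ->
  dot (\sum_(v <- us) c v *: v) u = c u.
Proof.
rewrite dotC dot_sumr.
elim: us => // v us IHus; rewrite orthonormal_seq_cons => /and3P[/eqP vv /allP vus ous].
rewrite inE big_cons dotZr => /predU1P[->|uus].
  rewrite vv mulr1 big1_seq ?addr0// => w /andP[_ wus].
  by rewrite dotZr (eqP (vus _ wus)) mulr0.
by rewrite IHus// dotC (eqP (vus _ uus)) mulr0 add0r.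
Qed.

Definition expands us w : Prop := w = \sum_(u <- us) dot w u *: u.

Lemma expandsD us v w : expands us v -> expands us w -> expands us (v + w).
Proof.
rewrite /expands => vE wE; rewrite {1}vE {1}wE -big_split; apply: eq_bigr => u _.
by rewrite dotDl scalerDl.
Qed.

Lemma expandsZ us a w : expands us w -> expands us (a *: w).
Proof.
rewrite /expands => wE; rewrite {1}wE scaler_sumr; apply: eq_bigr => u _.
by rewrite dotZl scalerA.
Qed.

Lemma expands_span us ws w : {in ws, forall v, expands us v} ->
  w \in <<ws>>%VS -> expands us w.
Proof.
move=> wsP /(coord_span (X := in_tuple ws)) ->.
elim/big_ind: _ => [|v v'|i _].
- by rewrite /expands big1// => u _; rewrite dot0l scale0r.
- exact: expandsD.
- by apply: expandsZ; apply: wsP; rewrite mem_nth.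
Qed.

Lemma gram_schmidt ws : exists us, [/\ orthonormal_seq us, (size us <= size ws)%N &
  {in ws, forall w, expands us w}].
Proof.
elim: ws => [|w ws [us [ous sz us_ws]]]; first by exists [::].
pose p := \sum_(u <- us) dot w u *: u; pose r := w - p.
have wE : w = r + p by rewrite /r subrK.
have ru u : u \in us -> dot r u = 0.
  by move=> uus; rewrite /r dotDl dotNl orthonormal_comb// subrr.
have [r0|r0] := eqVneq (dot r r) 0.
  exists us; split => // [|v]; first exact: ltnW.
  rewrite inE => /predU1P[->|/us_ws//].
  by rewrite /expands -/p {1}wE (dot_eq0 r0) add0r.
have rr : 0 < dot r r by rewrite lt_def r0 dot_ge0.
pose s := Num.sqrt (dot r r).
have s0 : s != 0 by rewrite gt_eqF// sqrtr_gt0.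
have rsE : dot r r = s ^+ 2 by rewrite sqr_sqrtr// ltW.
pose u0 := s^-1 *: r.
have u0us u : u \in us -> dot u0 u = 0 by move=> /ru ru0; rewrite dotZl ru0 mulr0.
have comb0 c : dot (\sum_(u <- us) c u *: u) u0 = 0.
  rewrite dotC dot_sumr big1_seq// => u /andP[_ /u0us u00].
  by rewrite dotZr u00 mulr0.
exists (u0 :: us); split => // [|v].
  rewrite orthonormal_seq_cons ous andbT; apply/andP; split.
    by rewrite dotZl dotZr rsE; apply/eqP; field.
  by apply/allP => u /u0us ->.
rewrite inE /expands big_cons => /predU1P[->|/us_ws vE].
  rewrite -/p {1}wE; congr (_ + _).
  by rewrite {1}wE dotDl comb0 addr0 dotZr rsE scalerA -[LHS]scale1r; congr (_ *: _); field.
by rewrite [in dot v u0]vE comb0 scale0r add0r.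
Qed.

Lemma dot_expands us e h : expands us h ->
  dot e h = \sum_(u <- us) dot h u * dot e u.
Proof. by move=> {1}->; rewrite dot_sumr; apply: eq_bigr => u _; rewrite dotZr. Qed.

(** Expand both sides in [us] and use |ab| <= a^2/4 + b^2 in each direction. *)
Lemma normr_dot_expands us e h : expands us h ->
  `|dot e h| <= dot h h / 4 + proj_sq us e.
Proof.
move=> hE; rewrite (dot_expands e hE) [dot h h](dot_expands h hE).
rewrite mulr_suml -big_split (le_trans (ler_norm_sum _ _ _))//.
apply: ler_sum => u _ /=; rewrite ler_norml; apply/andP; split.
  by have := sqr_ge0 (dot h u / 2 + dot e u); nra.
by have := sqr_ge0 (dot h u / 2 - dot e u); nra.
Qed.

End gram_schmidt.

(** * Counting the pieces of max-affine functions *)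

Section sign_patterns.
Context (R : realType) (vT : vectType R).
Implicit Types (l : 'Hom(vT, R^o)) (U : {vspace vT}).

Definition sign_pattern (ls : seq 'Hom(vT, R^o)) (u : vT) : seq bool :=
  [seq 0 <= (l u : R) | l : 'Hom(vT, R^o) <- ls].

(** Add one form [l] at a time.  A pattern of the other forms splits in two only
    if it is realized with both signs of [l]; a positive combination of two
    such points lies in the kernel of [l] and still realizes the pattern.  So
    the number of splits is at most the number of patterns on the kernel,
    which has one dimension less, and (N+1)^D + (N+1)^(D-1) <= (N+2)^D. *)
Lemma card_sign_patterns (ls : seq 'Hom(vT, R^o)) U :
  exists ps : seq (seq bool), (size ps <= (size ls).+1 ^ \dim U)%N /\
    {in U, forall u, sign_pattern ls u \in ps}.
Proof.
have monoX a b k : (a <= b -> a ^ k <= b ^ k)%N by case: k => // k; rewrite leq_exp2r.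
elim: ls U => [|l ls IHls] U; first by exists [:: [::]]; rewrite exp1n.
have [ps [szps psP]] := IHls U.
have [lU0|lU0] := eqVneq (l @: U)%VS 0%VS.
  exists [seq true :: p | p <- ps]; split.
    by rewrite size_map (leq_trans szps)//; exact: monoX.
  move=> u uU; rewrite /=.
  have -> : l u = 0 by apply/eqP; rewrite -memv0 -lU0 memv_img.
  by rewrite lexx map_f// psP.
pose K := (U :&: lker l)%VS.
have dimK : \dim U = (\dim K).+1.
  have := limg_ker_dim l U; rewrite -/K => <-; rewrite -addn1; congr (_ + _)%N.
  apply/eqP; rewrite eqn_leq lt0n dimv_eq0 lU0 andbT.
  by rewrite (leq_trans (dimvS (subvf _)))// dimvf.
have [ps' [szps' ps'P]] := IHls K.
pose split_true p := `[< exists2 u, u \in U & sign_pattern ls u = p /\ 0 <= (l u : R) >].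
exists ([seq split_true p :: p | p <- ps] ++ [seq false :: p | p <- ps']); split.
  rewrite size_cat !size_map dimK.
  apply: leq_trans (_ : (size ls).+1 ^ (\dim K).+1 + (size ls).+1 ^ \dim K <= _)%N.
    by rewrite leq_add// -dimK.
  rewrite /= expnS -mulSnr expnS leq_mul2l /=.
  exact: monoX.
move=> u uU; rewrite mem_cat /=.
have [lu0|lu0] := leP 0 (l u : R).
  apply/orP; left; rewrite -[true](_ : split_true (sign_pattern ls u) = _).
    by apply: (map_f (fun p => split_true p :: p)); exact: psP.
  by apply/asboolP; exists u.
have [/asboolP[u' u'U [pu' lu'0]]|/negbTE nsplit] := boolP (split_true (sign_pattern ls u)).
  apply/orP; right; apply: map_f.
  pose t : R := (l u' : R) - l u.
  have t0 : 0 < t by rewrite subr_gt0 (lt_le_trans lu0).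
  pose v := (l u' : R) *: u - (l u : R) *: u'.
  have vK : v \in K.
    rewrite memv_cap rpredB ?rpredZ//= memv_ker.
    have -> : l v = (l u' : R) * l u - (l u : R) * l u' by rewrite linearB !linearZ.
    by rewrite mulrC subrr.
  rewrite (_ : sign_pattern ls u = sign_pattern ls v); first exact: ps'P.
  apply/eq_in_map => l' l'ls /=.
  have : (0 <= (l' u : R)) = (0 <= (l' u' : R)).
    have /(congr1 (nth false ^~ (index l' ls))) := pu'.
    by rewrite !(nth_map (0 : 'Hom(vT, R^o))) ?index_mem// nth_index.
  have -> : (l' v : R) = (l u' : R) * l' u - (l u : R) * l' u' by rewrite linearB !linearZ.
  case: (leP 0 (l' u : R)) => l'u /esym; first by move=> l'u'; apply/esym; nra.
  by move=> /negbT; rewrite -ltNge => l'u'; apply/esym/negbTE; rewrite -ltNge; nra.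
by apply/orP; left; rewrite -nsplit; apply: (map_f (fun p => split_true p :: p)); exact: psP.
Qed.

End sign_patterns.

Section max_of_linear_forms.
Context (R : realType) (vT : vectType R) (n m : nat).
Variable ev : 'I_n -> 'I_m -> 'Hom(vT, R^o).

Section selection.
Variable sel : 'I_n -> 'I_m.
Definition selected_values (p : vT) : 'rV[R]_n := \row_i (ev i (sel i) p : R).

Fact selected_values_is_linear : linear selected_values.
Proof. by move=> a u v; apply/rowP => i; rewrite !mxE linearP. Qed.

HB.instance Definition _ :=
  GRing.isLinear.Build R vT 'rV[R]_n _ selected_values selected_values_is_linear.
End selection.

(** The signs of the differences of the forms determine, at each i, an index
    attaining the maximum.  Once these indices are fixed the vector of maxima
    is a linear image of the parameter. *)
Lemma max_values_cover (j0 : 'I_m) : exists S : seq (seq 'rV[R]_n),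
  [/\ (size S <= (n * (m * m)).+1 ^ \dim {: vT})%N,
      {in S, forall ws, (size ws <= \dim {: vT})%N} &
      forall (p : vT) (h : 'rV[R]_n),
        (forall i, exists2 j, h 0 i = ev i j p & forall k, (ev i k p : R) <= h 0 i) ->
        exists2 ws, ws \in S & h \in <<ws>>%VS].
Proof.
pose idx := enum {: 'I_n * ('I_m * 'I_m)}.
pose form (t : 'I_n * ('I_m * 'I_m)) := ev t.1 t.2.1 - ev t.1 t.2.2.
have [ps [szps psP]] := card_sign_patterns [seq form t | t <- idx] fullv.
pose sgn (s : seq bool) i j k := nth false s (index (i, (j, k)) idx).
(* The default [j0] is never reached on a realized pattern. *)
pose sel s i := odflt j0 [pick j | [forall k, sgn s i j k]].
pose basis s := vbasis (limg (linfun (selected_values (sel s)))) : seq _.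
exists [seq basis s | s <- ps]; split.
- rewrite size_map (leq_trans szps)// size_map -cardE !card_prod !card_ord.
  exact: leqnn.
- move=> _ /mapP[s _ ->]; rewrite size_tuple.
  by rewrite -(limg_ker_dim (linfun (selected_values (sel s))) fullv) leq_addl.
move=> p h hP; pose s := sign_pattern [seq form t | t <- idx] p.
exists (basis s); first by apply: map_f; apply: psP; exact: memvf.
suff -> : h = linfun (selected_values (sel s)) p.
  by rewrite (span_basis (vbasisP _)) memv_img// memvf.
have sgnE i j k : sgn s i j k = ((ev i k p : R) <= ev i j p).
  have ijk : (i, (j, k)) \in idx by rewrite mem_enum.
  rewrite /sgn /s /sign_pattern -map_comp (nth_map (i, (j, k))) ?index_mem//.
  by rewrite nth_index//= /form add_lfunE opp_lfunE; exact: subr_ge0.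
rewrite lfunE; apply/rowP => i; rewrite mxE /= /sel.
have [j hj jP] := hP i.
case: pickP => [j' /forallP j'P|/(_ j)/negbT/forallPn[k]] /=.
  apply/eqP; rewrite eq_le jP andbT hj.
  by have := j'P j; rewrite sgnE.
by rewrite sgnE -hj jP.
Qed.

End max_of_linear_forms.

Section max_affine_cover.
Context (R : realType) (d n : nat) (x : 'I_n -> 'rV[R]_d).

Definition values_at (f : 'rV[R]_d -> R) : 'rV[R]_n := \row_i f (x i).

Lemma max_affineP m (theta : m.-tuple (d.-tuple R * R)) y (j0 : 'I_m) :
  (exists j, max_affine theta y = affine (tnth theta j) y) /\
  (forall k, affine (tnth theta k) y <= max_affine theta y).
Proof.
split; last by move=> k; rewrite /max_affine (bigmax_sup k).
have a0E : exists j, affine (head ([tuple of nseq d 0], 0) theta) y =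
    affine (tnth theta j) y.
  case: m theta j0 => [|m'] theta j0; first by case: j0.
  by exists ord0; rewrite (tnth_nth ([tuple of nseq d 0], 0)) nth0.
rewrite /max_affine.
elim/big_ind: _ => // [u v [j uE] [k vE]|i _]; last by exists i.
by case: (leP u v) => _; [exists k|exists j].
Qed.

(** Tuples of pairs carry no vector space structure; matrices do. *)
Definition param_vec m (theta : m.-tuple (d.-tuple R * R)) : 'M[R]_(m, d) * 'cV[R]_m :=
  (\matrix_(j, t) tnth (tnth theta j).1 t, \col_j (tnth theta j).2).

Section affine_form.
Context (m : nat) (i : 'I_n) (j : 'I_m).
Definition affine_form (p : 'M[R]_(m, d) * 'cV[R]_m) : R^o :=
  \sum_(t < d) p.1 j t * x i 0 t + p.2 j 0.

Fact affine_form_is_linear : linear affine_form.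
Proof.
move=> a u v; rewrite /affine_form /= !mxE scalerDr addrACA scaler_sumr -big_split.
congr (_ + _); apply: eq_bigr => t _.
by rewrite !mxE mulrDl -mulrA.
Qed.

HB.instance Definition _ := GRing.isLinear.Build R _ R^o _ affine_form affine_form_is_linear.

End affine_form.

Lemma affine_form_vec m (theta : m.-tuple (d.-tuple R * R)) i j :
  affine_form i j (param_vec theta) = affine (tnth theta j) (x i).
Proof. by rewrite /affine_form /= mxE; congr (_ + _); apply: eq_bigr => t _; rewrite mxE. Qed.

Lemma max_affine_cover m : (0 < m)%N -> exists S : seq (seq 'rV[R]_n),
  [/\ (size S <= (n * (m * m)).+1 ^ (m * d.+1))%N,
      {in S, forall ws, (size ws <= m * d.+1)%N} &
      forall theta : m.-tuple (d.-tuple R * R),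
        exists2 ws, ws \in S & values_at (max_affine theta) \in <<ws>>%VS].
Proof.
case: m => // m _.
have [S] := max_values_cover (fun i j => linfun (@affine_form m.+1 i j)) ord0.
have -> : \dim {: ('M[R]_(m.+1, d) * 'cV[R]_m.+1)%type} = (m.+1 * d.+1)%N.
  rewrite dimvf /dim /= !dim_matrix -[LHS]/(m.+1 * d + m.+1 * 1)%N.
  by rewrite muln1 addnC -mulnS.
move=> [szS Sws SP].
exists S; split => // theta; apply: (SP (param_vec theta)) => i.
have [[j jE] kP] := max_affineP theta (x i) ord0.
exists j => [|k]; first by rewrite mxE jE lfunE /= affine_form_vec.
by rewrite lfunE /= affine_form_vec mxE.
Qed.

(** Adjoining the values of [f0] to each spanning family puts the residuals in
    the span, at the cost of one dimension. *)
Lemma residual_cover m (f0 : 'rV[R]_d -> R) : (0 < m)%N ->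
  exists S : seq (seq 'rV[R]_n),
  [/\ (size S <= (n * (m * m)).+1 ^ (m * d.+1))%N,
      {in S, forall us, orthonormal_seq us /\ (size us <= (m * d.+1).+1)%N} &
      forall (theta : m.-tuple (d.-tuple R * R)), exists2 us, us \in S &
        expands us (values_at (max_affine theta) - values_at f0)].
Proof.
move=> m0; have [S [szS Sws SP]] := max_affine_cover m0.
have /choice[gs gsP] := fun ws => @gram_schmidt R n (values_at f0 :: ws).
exists [seq gs ws | ws <- S]; split; first by rewrite size_map.
  move=> _ /mapP[ws /Sws szws ->]; have [ogs szgs _] := gsP ws.
  by split => //; rewrite (leq_trans szgs).
move=> theta; have [ws wsS hws] := SP theta.
exists (gs ws); first exact: map_f.
have [_ _ ews] := gsP ws; apply: (expands_span ews).
apply: rpredB; last by apply: memv_span; exact: mem_head.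
by apply: (subvP (sub_span _)) hws => w wws; rewrite inE wws orbT.
Qed.

End max_affine_cover.

(** * Series and numerical bounds *)

Section series.
Context (R : realType).
Local Open Scope ereal_scope.

Lemma nneseries_le (u : nat -> \bar R) N c : (forall m, (N <= m)%N -> 0 <= u m) ->
  (forall k, \sum_(N <= m < k) u m <= c) -> \sum_(N <= m <oo) u m <= c.
Proof.
move=> u0 uc; apply: lime_le.
  by apply: is_cvg_ereal_nneg_natsum_cond => m Nm _; exact: u0.
by apply: nearW => k; exact: uc.
Qed.

Lemma nneseries_ge_partial (u : nat -> \bar R) N k :
  (forall m, (N <= m)%N -> 0 <= u m) ->
  \sum_(N <= m < k) u m <= \sum_(N <= m <oo) u m.
Proof. by move=> u0; apply: nneseries_lim_ge => m Nm _; exact: u0. Qed.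

Lemma lee_nneseries_from (u v : nat -> \bar R) N :
  (forall m, (N <= m)%N -> 0 <= u m) -> (forall m, (N <= m)%N -> u m <= v m) ->
  \sum_(N <= m <oo) u m <= \sum_(N <= m <oo) v m.
Proof.
move=> u0 uv; apply: nneseries_le => // k.
apply: le_trans (_ : \sum_(N <= m < k) v m <= _).
  by rewrite big_nat_cond [leRHS]big_nat_cond lee_sum// => m /andP[/andP[/uv]].
by apply: nneseries_ge_partial => m Nm; apply: le_trans (u0 _ Nm) (uv _ Nm).
Qed.

Lemma nneseries_ge_term (u : nat -> \bar R) N m : (forall m, (N <= m)%N -> 0 <= u m) ->
  (N <= m)%N -> u m <= \sum_(N <= m <oo) u m.
Proof.
move=> u0 Nm; apply: (@le_trans _ _ (\sum_(N <= k < m.+1) u k)).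
  rewrite big_nat_recr//= leeDr// big_nat_cond sume_ge0// => k /andP[/andP[+ _] _].
  exact: u0.
exact: nneseries_ge_partial.
Qed.

Lemma geometric_half_series (u : nat -> \bar R) N c : (0 <= c)%R ->
  (forall m, (N <= m)%N -> 0 <= u m <= (c * 2^-1 ^+ (m.+1 - N))%:E) ->
  \sum_(N <= m <oo) u m <= c%:E.
Proof.
move=> c0 uc; apply: nneseries_le => [m /uc/andP[]//|k].
apply: (@le_trans _ _ (\sum_(N <= m < k) (c * 2^-1 ^+ (m.+1 - N))%:E)).
  by rewrite big_nat_cond [leRHS]big_nat_cond lee_sum// => m /andP[/andP[/uc/andP[]]].
have -> : \sum_(N <= m < k) (c * 2^-1 ^+ (m.+1 - N))%:E = (c * (1 - 2^-1 ^+ (k - N)))%:E.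
  have [kN|/ltnW Nk] := leqP k N.
    by rewrite big_geq// (eqP kN) expr0 subrr mulr0.
  rewrite -{1}(subnK Nk); elim: (k - N)%N => [|j IHj].
    by rewrite big_geq// expr0 subrr mulr0.
  rewrite addSn big_nat_recr ?leq_addl//= IHj -EFinD -addSn addnK exprS.
  by congr _%:E; field.
by rewrite lee_fin ler_piMr// gerBl exprn_ge0.
Qed.

End series.

Section logarithms.
Context (R : realType).

Lemma expR_half_le2 : expR (2^-1) <= 2 :> R.
Proof.
have := @expR_ge1Dx R (- 2^-1); rewrite expRN => h.
rewrite -[leRHS]invrK -[leLHS]invrK lef_pV2 ?posrE ?invr_gt0 ?expR_gt0//.
by apply: le_trans h; lra.
Qed.

Lemma ln_nat_ge_half k : (2 <= k)%N -> 2^-1 <= ln k%:R :> R.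
Proof.
move=> k2; rewrite -ler_expR lnK ?posrE ?ltr0n; last exact: leq_trans k2.
by rewrite (le_trans expR_half_le2)// ler_nat.
Qed.

Lemma expRN1_le_half : expR (- 1) <= 2^-1 :> R.
Proof.
rewrite expRN lef_pV2 ?posrE ?expR_gt0//.
by have := @expR_ge1Dx R 1; rewrite -natr1.
Qed.

Lemma sqrt2_bounds : 1 <= Num.sqrt (2 : R) <= expR (2^-1).
Proof.
rewrite -{1}sqrtr1 ler_sqrt// ler1n /=.
rewrite -[leRHS]ger0_norm ?expR_ge0// -sqrtr_sqr ler_sqrt ?sqr_ge0//.
rewrite expr2 -expRD; have := @expR_ge1Dx R 1.
by rewrite (_ : 2^-1 + 2^-1 = 1 :> R) ?natr1//; field.
Qed.

(** The union bound: the number of spaces times the exponential moment of each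
    projection, of dimension at most m(d+1) + 1, is at most exp(22 D_m).  All
    constants come from ln n, ln(3m) >= 1/2. *)
Lemma count_bound d n m : (2 <= n)%N -> (0 < d)%N -> (0 < m)%N ->
  ((n * (m * m)).+1 ^ (m * d.+1))%:R * Num.sqrt 2 ^+ (m * d.+1).+1 <=
  expR (22 * (d%:R * ln n%:R * (m%:R * ln (3 * m)%:R))) :> R.
Proof.
move=> n2 d0 m0; set l := ln n%:R; set l3 := ln (3 * m)%:R.
have lh : 2^-1 <= l by exact: ln_nat_ge_half.
have l3h : 2^-1 <= l3 by apply: ln_nat_ge_half; rewrite (leq_trans (_ : 2 <= 3 * 1)%N)// leq_mul.
have d1 : 1 <= d%:R :> R by rewrite ler1n.
have m1 : 1 <= m%:R :> R by rewrite ler1n.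
have md1 : 1 <= m%:R * d%:R :> R by rewrite -natrM ler1n muln_gt0 m0.
have ll : 1 <= 4 * (l * l3) by nra.
have base : (n * (m * m)).+1%:R <= expR (8 * (l * l3)) :> R.
  apply: (@le_trans _ _ (expR (2 * l + 2 * l3))); last by rewrite ler_expR; nra.
  rewrite expRD ![2 * _]mulrC !expRM_natr !lnK ?posrE ?ltr0n ?muln_gt0 ?(ltnW n2)//.
  rewrite -!natrX -natrM ler_nat -!mulnn; nia.
rewrite natrX.
apply: (@le_trans _ _ (expR (8 * (l * l3)) ^+ (m * d.+1) * expR (2^-1) ^+ (m * d.+1).+1)).
  rewrite ler_pM ?exprn_ge0 ?sqrtr_ge0// lerXn2r ?nnegrE ?expR_ge0 ?sqrtr_ge0//.
  by case/andP: sqrt2_bounds.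
rewrite -!expRM_natr -expRD ler_expR.
rewrite -[(m * d.+1).+1]addn1 natrD natrM -[d.+1]addn1 natrD.
have mddm : m%:R * (d%:R + 1) <= 2 * (m%:R * d%:R) :> R by nra.
have : (8 * (l * l3)) * (m%:R * (d%:R + 1)) <= (8 * (l * l3)) * (2 * (m%:R * d%:R)).
  by rewrite ler_wpM2l//; lra.
have : m%:R * d%:R <= (4 * (l * l3)) * (m%:R * d%:R).
  by rewrite ler_peMl//; lra.
lra.
Qed.

(** The prior mass of the box: each of its m(d+1) sides has length n^-2 and
    density at least half the lower bound on tau; the factor 1/2 is at least 1/n. *)
Lemma small_ball_bound (eta : R) d n m : 0 < eta -> (2 <= n)%N -> (0 < d)%N -> (0 < m)%N ->
  expR (- ((12 + 1 / (4 * eta)) * (d%:R * ln n%:R * (m%:R * ln (3 * m)%:R)))) <=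
  (expR (- (ln n%:R * ln (3 * m)%:R / (8 * eta))) / 2 * (n%:R ^- 2)) ^+ (m * d.+1) :> R.
Proof.
move=> eta0 n2 d0 m0; set l := ln n%:R; set l3 := ln (3 * m)%:R.
have lh : 2^-1 <= l by exact: ln_nat_ge_half.
have l3h : 2^-1 <= l3 by apply: ln_nat_ge_half; rewrite (leq_trans (_ : 2 <= 3 * 1)%N)// leq_mul.
have d1 : 1 <= d%:R :> R by rewrite ler1n.
have m1 : 1 <= m%:R :> R by rewrite ler1n.
have n0 : (0 < n)%N by exact: ltnW.
have nE : n%:R = expR l by rewrite lnK// posrE ltr0n.
pose q := 6 + 1 / (8 * eta).
have q0 : 0 <= q by rewrite addr_ge0// divr_ge0 ?mulr_ge0 ?ltW.
have base : expR (- (q * (l * l3))) <=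
    expR (- (l * l3 / (8 * eta))) / 2 * (n%:R ^- 2).
  apply: (@le_trans _ _ (expR (- (l * l3 / (8 * eta))) / n%:R * (n%:R ^- 2))).
    rewrite nE -expRM_natr -!expRN -!expRD ler_expR.
    rewrite /q mulrDl; have : l <= 2 * (l * l3) by nra.
    have -> : 1 / (8 * eta) * (l * l3) = l * l3 / (8 * eta) by field; rewrite gt_eqF.
    lra.
  rewrite ler_wpM2r ?invr_ge0 ?exprn_ge0// ler_wpM2l ?expR_ge0//.
  by rewrite lef_pV2 ?posrE ?ltr0n// ler_nat.
apply: (@le_trans _ _ (expR (- (q * (l * l3))) ^+ (m * d.+1))); last first.
  by rewrite lerXn2r ?nnegrE ?expR_ge0// (le_trans _ base) ?expR_ge0.
rewrite -expRM_natr ler_expR mulNr lerN2 natrM -[d.+1]addn1 natrD.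
have -> : (12 + 1 / (4 * eta)) = q * 2 by rewrite /q; field; rewrite gt_eqF.
have -> : q * 2 * (d%:R * l * (m%:R * l3)) = (q * (l * l3)) * (2 * (m%:R * d%:R)) by ring.
by apply: ler_wpM2l; [apply: mulr_ge0 => //; nra|nra].
Qed.

End logarithms.

(** * Likelihood and prior *)

Section likelihood.
Context (R : realType) (d n : nat) (x : 'I_n -> 'rV[R]_d).
Implicit Types (f : 'rV[R]_d -> R) (y e : n.-tuple R).

Definition residual f f0 : 'rV[R]_n := values_at x f - values_at x f0.

Lemma ell2E f f0 : ell2 x f f0 = n%:R^-1 * dot (residual f f0) (residual f f0).
Proof. by congr (_ * _); apply: eq_bigr => i _; rewrite !mxE -expr2. Qed.

Definition shifted f0 e : n.-tuple R := [tuple f0 (x i) + tnth e i | i < n].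

Lemma likelihood_ratio f f0 e :
  likelihood x (shifted f0 e) f = likelihood x (shifted f0 e) f0 *
    expR (dot (noise_vec e) (residual f f0) - dot (residual f f0) (residual f f0) / 2).
Proof.
rewrite /dot mulr_suml -sumrB expR_sum -big_split; apply: eq_bigr => i _ /=.
rewrite !mxE tnth_mktuple !normal_pdfE ?oner_neq0// -[RHS]mulrA; congr (_ * _).
by rewrite /normal_fun -expRD; congr expR; rewrite expr1n; field.
Qed.

Lemma likelihood_gt0 f y : 0 < likelihood x y f.
Proof.
apply: prodr_gt0 => i _; rewrite normal_pdfE ?oner_neq0//.
by rewrite mulr_gt0 ?expR_gt0 ?normal_peak_gt0 ?oner_neq0.
Qed.

Lemma likelihood_le f y : likelihood x y f <= normal_peak 1 ^+ n.
Proof.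
rewrite -[X in _ ^+ X](card_ord n) -prodr_const; apply: ler_prod => i _.
by rewrite normal_pdf_ge0 normal_pdf_ub ?oner_neq0.
Qed.

End likelihood.

Section prior.
Context (R : realType) (d : nat) (g : R -> R) (gP : prior_density g).
Local Open Scope ereal_scope.

Let mg : measurable_fun setT g. Proof. by case: gP. Qed.
Let g0 t : (0 <= g t)%R. Proof. by case: gP. Qed.
Let g1 : \int[lebesgue_measure]_t (g t)%:E = 1. Proof. by case: gP. Qed.

Lemma param_density_ge0 m (theta : m.-tuple (d.-tuple R * R)) :
  (0 <= param_density g theta)%R.
Proof. by apply: prodr_ge0 => i _; rewrite mulr_ge0// prodr_ge0. Qed.

Lemma integral_param_density m (k : R) : (0 <= k)%R ->
  \int[@param_lebesgue R d m]_theta (k * param_density g theta)%:E = k%:E.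
Proof.
move=> k0; rewrite (integral_param_prod (F := fun _ _ => g) (G := fun _ => g)
  (a := fun _ _ => 1%R) (b := fun _ => 1%R))//.
by rewrite big1 ?mulr1// => i _; rewrite big1 ?mulr1.
Qed.

Lemma prior_slice_le m (D : set (m.-tuple (d.-tuple R * R)))
    (L : m.-tuple (d.-tuple R * R) -> R) (B : R) : (0 <= B)%R ->
  (forall theta, D theta -> 0 <= L theta <= B)%R ->
  \int[@param_lebesgue R d m]_(theta in D) (L theta * param_density g theta)%:E <= B%:E.
Proof.
move=> B0 LB; apply: (@le_trans _ _
  (\int[@param_lebesgue R d m]_theta (B * param_density g theta)%:E)).
  apply: ge0_le_integral_param => theta.
  - by move=> /LB/andP[L0 _]; rewrite lee_fin mulr_ge0// param_density_ge0.
  - by rewrite lee_fin mulr_ge0// param_density_ge0.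
  - by move=> /LB/andP[_ LleB]; rewrite lee_fin ler_wpM2r// param_density_ge0.
by rewrite integral_param_density.
Qed.

(** An interval of length [delta] next to [a] that points away from 0.  It never
    contains 0, where a density non-increasing on (0,oo) is uncontrolled. *)
Definition away_interval (a delta : R) : set R :=
  if (0 <= a)%R then `]a, (a + delta)%R]%classic else `[(a - delta)%R, a[%classic.

Lemma measurable_away_interval a delta : measurable (away_interval a delta).
Proof. by rewrite /away_interval; case: ifP. Qed.

Lemma lebesgue_away_interval a delta : (0 < delta)%R ->
  lebesgue_measure (away_interval a delta) = delta%:E.
Proof.
move=> delta0; rewrite /away_interval; case: ifP => _.
  by rewrite lebesgue_measure_itv/= lte_fin ltrDl delta0 -EFinB addrAC subrr add0r.
by rewrite lebesgue_measure_itv/= lte_fin gtrBl delta0 -EFinB opprB addrCA subrr addr0.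
Qed.

Lemma away_interval_near a delta t : away_interval a delta t -> (`|t - a| <= delta)%R.
Proof.
by rewrite /away_interval; case: ifP => _ /=; rewrite in_itv/= => /andP[h1 h2];
  rewrite ler_norml; apply/andP; split; lra.
Qed.

Lemma density_away_interval a delta t s : (0 < delta <= 1)%R ->
  away_interval a delta t -> (`|a| + 1 <= s)%R -> (g s <= g t)%R.
Proof.
case: gP => _ _ _ gN gmono /andP[delta0 delta1] + as_.
have gabs u : g u = g `|u|%R.
  have [u0|u0] := leP 0%R u; first by rewrite ger0_norm.
  by rewrite ltr0_norm// gN.
rewrite (gabs t) /away_interval; case: ifP => [a0|/negbT a0]; rewrite /= in_itv/= => /andP[h1 h2].
  have t0 : (0 < t)%R by exact: le_lt_trans h1.
  by apply: gmono; rewrite gtr0_norm//; move: as_; rewrite ger0_norm//; lra.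
move: a0; rewrite -ltNge => a0.
have t0 : (t < 0)%R by exact: lt_trans a0.
by apply: gmono; rewrite ltr0_norm//; move: as_; rewrite ?ltr0_norm//; lra.
Qed.

Definition away_box m (theta0 : m.-tuple (d.-tuple R * R)) (delta : R) :
    set (m.-tuple (d.-tuple R * R)) :=
  [set theta | forall i,
    (forall j, away_interval (tnth (tnth theta0 i).1 j) delta (tnth (tnth theta i).1 j)) /\
    away_interval (tnth theta0 i).2 delta (tnth theta i).2].

(** On the box the density is at least [T] in each coordinate, so the integrand
    dominates [B] times a product of the functions [T * \1_I]. *)
Lemma prior_slice_ge m (theta0 : m.-tuple (d.-tuple R * R))
    (L : m.-tuple (d.-tuple R * R) -> R) (B T delta : R) :
  (0 <= B)%R -> (0 <= T)%R -> (0 < delta <= 1)%R ->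
  (forall i, T <= g (sup_norm (tnth theta0 i).1 + 1))%R ->
  (forall i, T <= g (`|(tnth theta0 i).2| + 1))%R ->
  (forall theta, 0 <= L theta)%R ->
  (forall theta, away_box theta0 delta theta -> B <= L theta)%R ->
  (B * (T * delta) ^+ (m * d.+1))%:E <=
  \int[@param_lebesgue R d m]_(theta in setT) (L theta * param_density g theta)%:E.
Proof.
move=> B0 T0 delta01 Ta Tb L0 LB.
have delta0 : (0 < delta)%R by case/andP: delta01.
pose Ia i j := away_interval (tnth (tnth theta0 i).1 j) delta.
pose Ib i := away_interval (tnth theta0 i).2 delta.
have int_indic (a : R) :
    \int[lebesgue_measure]_t (T * \1_(away_interval a delta) t)%:E = (T * delta)%:E.
  under eq_integral do rewrite EFinM.
  rewrite ge0_integralZl//; last first.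
    apply/measurable_EFinP; apply: measurable_indic; exact: measurable_away_interval.
  rewrite integral_indic//; last exact: measurable_away_interval.
  by rewrite setIT EFinM; congr (_ * _); exact: lebesgue_away_interval.
have mindic (a : R) : measurable_fun [set: measurableTypeR R]
    (fun t => T * \1_(away_interval a delta) t)%R.
  by apply: measurable_funM => //; apply: measurable_indic; exact: measurable_away_interval.
have := @integral_param_prod R d m B (fun i j t => T * \1_(Ia i j) t)%R
  (fun i t => T * \1_(Ib i) t)%R (fun _ _ => T * delta)%R (fun _ => T * delta)%R B0.
rewrite (_ : \prod_(i < m) _ = (T * delta) ^+ (m * d.+1))%R; last first.
  by rewrite !prodr_const !card_ord -exprSr -exprM mulnC.
move=> <- //; do ?[by move=> *; rewrite mulr_ge0
  | by move=> *; exact: int_indic | by move=> *; exact: mindic].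
apply: ge0_le_integral_param => theta.
- move=> _; rewrite lee_fin mulr_ge0// prodr_ge0// => i _.
  by rewrite !mulr_ge0// prodr_ge0// => j _; rewrite mulr_ge0.
- by rewrite lee_fin mulr_ge0// param_density_ge0.
move=> _; rewrite lee_fin.
have [box|nbox] := pselect (away_box theta0 delta theta).
  apply: ler_pM => //.
  - by rewrite prodr_ge0// => i _; rewrite !mulr_ge0// prodr_ge0// => j _; rewrite mulr_ge0.
  - exact: LB.
  have le_g t a s : away_interval a delta t -> (`|a| + 1 <= s -> T <= g s ->
      T * \1_(away_interval a delta) t <= g t)%R.
    move=> ta as_ Ts; apply: le_trans (density_away_interval delta01 ta as_).
    by rewrite indicE mem_set// mulr1.
  apply: ler_prod => i _; have [boxa boxb] := box i; apply/andP; split.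
    by rewrite !mulr_ge0// prodr_ge0// => j _; rewrite mulr_ge0.
  apply: ler_pM; rewrite ?mulr_ge0//.
  - by rewrite prodr_ge0// => j _; rewrite mulr_ge0.
  - apply: ler_prod => j _; rewrite mulr_ge0//=.
    apply: le_g (boxa j) _ (Ta i); rewrite lerD2r /sup_norm.
    by rewrite (bigmax_sup j).
  - exact: le_g boxb _ (Tb i).
suff -> : (\prod_(i < m) ((\prod_(j < d) (T * \1_(Ia i j) (tnth (tnth theta i).1 j))) *
    (T * \1_(Ib i) (tnth theta i).2)) = 0)%R.
  by rewrite mulr0 mulr_ge0// param_density_ge0.
apply/eqP; apply: contraT => /prodf_neq0 nz; exfalso; apply: nbox => i.
have := nz i isT; rewrite !mulf_eq0 !negb_or => /and3P[/prodf_neq0 nza _ nzb].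
have indic_in (A : set R) t : \1_A t != 0%R :> R -> A t.
  by rewrite indicE; case: (boolP (t \in A)) => [/set_mem//|]; rewrite eqxx.
split => [j|]; last exact: indic_in nzb.
by have := nza j isT; rewrite mulf_eq0 negb_or => /andP[_ /indic_in].
Qed.

End prior.

Section posterior_bounds.
Context (R : realType) (d : nat) (g : R -> R) (gP : prior_density g).
Context (lam : nat -> R) (lam0 : forall m, (0 < m)%N -> 0 <= lam m).
Hypothesis lam1 : (\sum_(1 <= m <oo) (lam m)%:E = 1)%E.
Implicit Types (A : set ('rV[R]_d -> R)) (L : ('rV[R]_d -> R) -> R).
Local Open Scope ereal_scope.

Lemma prior_slice_ge0 m A L : (forall f, 0 <= L f)%R -> (0 < m)%N ->
  0 <= (lam m)%:E * \int[@param_lebesgue R d m]_(theta in @max_affine R d m @^-1` A)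
         (L (max_affine theta) * param_density g theta)%:E.
Proof.
move=> L0 m0; rewrite mule_ge0 ?lee_fin ?lam0// integral_param_ge0// => theta _.
by rewrite lee_fin mulr_ge0// param_density_ge0.
Qed.

Lemma prior_integral_ge0 A L : (forall f, 0 <= L f)%R -> 0 <= prior_integral g lam A L.
Proof.
move=> L0; have := prior_slice_ge0 A L0 (isT : (0 < 1)%N).
move=> /le_trans; apply; apply: (nneseries_ge_term (u := fun m => _)) => // m m0.
exact: prior_slice_ge0.
Qed.

Lemma prior_integral_subset A L : (forall f, 0 <= L f)%R ->
  prior_integral g lam A L <= prior_integral g lam setT L.
Proof.
move=> L0; apply: lee_nneseries_from => m m0; first exact: prior_slice_ge0.
rewrite lee_wpmul2l ?lee_fin ?lam0//.
apply: ge0_le_integral_param => theta *; rewrite ?lee_fin ?mulr_ge0 ?param_density_ge0//.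
Qed.

Lemma prior_integral_bounded L B : (forall f, 0 <= L f <= B)%R ->
  prior_integral g lam setT L <= B%:E.
Proof.
move=> LB; have L0 f : (0 <= L f)%R by case/andP: (LB f).
have B0 : (0 <= B)%R by rewrite (le_trans (L0 (fun=> 0%R)))//; case/andP: (LB (fun=> 0%R)).
apply: nneseries_le => [m m0|k]; first exact: prior_slice_ge0.
apply: (@le_trans _ _ (\sum_(1 <= m < k) (B * lam m)%:E)).
  rewrite big_nat_cond [leRHS]big_nat_cond lee_sum// => m /andP[/andP[m0 _] _].
  by rewrite mulrC EFinM lee_wpmul2l ?lee_fin ?lam0// prior_slice_le.
rewrite sumEFin -mulr_sumr lee_fin -[leRHS]mulr1 ler_wpM2l// -lee_fin -sumEFin -lam1.
by apply: nneseries_ge_partial => m m0; rewrite lee_fin lam0.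
Qed.

Context (n : nat) (x : 'I_n -> 'rV[R]_d) (y : n.-tuple R).
Notation den := (prior_integral g lam setT (likelihood x y)).

Let lik0 f : (0 <= likelihood x y f)%R. Proof. exact/ltW/likelihood_gt0. Qed.

Let den_fin : den \is a fin_num.
Proof.
rewrite ge0_fin_numE ?prior_integral_ge0//.
apply: le_lt_trans (ltry (normal_peak (1 : R) ^+ n)).
by apply: prior_integral_bounded => f; rewrite lik0 likelihood_le.
Qed.

Let num_fin A : prior_integral g lam A (likelihood x y) \is a fin_num.
Proof.
rewrite ge0_fin_numE ?prior_integral_ge0//.
by apply: le_lt_trans (prior_integral_subset A lik0) _; rewrite -ge0_fin_numE ?prior_integral_ge0.
Qed.

Lemma posterior_ge0 A : (0 <= posterior x g lam A y)%R.
Proof. by rewrite divr_ge0// fine_ge0// prior_integral_ge0. Qed.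

Lemma posterior_le1 A : (posterior x g lam A y <= 1)%R.
Proof.
rewrite /posterior; have [->|den0] := eqVneq (fine den) 0%R.
  by rewrite invr0 mulr0.
have : (0 <= fine den)%R by rewrite fine_ge0// prior_integral_ge0.
rewrite le_eqVlt eq_sym (negbTE den0) /= => {}den0.
by rewrite ler_pdivrMr// mul1r fine_le// prior_integral_subset.
Qed.

Lemma posterior_le_ratio A (a b : R) : (0 < b)%R ->
  prior_integral g lam A (likelihood x y) <= a%:E -> b%:E <= den ->
  (posterior x g lam A y <= a / b)%R.
Proof.
move=> b0 na bden.
have fden : (b <= fine den)%R by rewrite -lee_fin fineK.
have fnum : (fine (prior_integral g lam A (likelihood x y)) <= a)%R by rewrite -lee_fin fineK.
rewrite ler_pM ?fine_ge0 ?prior_integral_ge0// ?invr_ge0 ?fine_ge0 ?prior_integral_ge0//.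
by rewrite lef_pV2 ?posrE// (lt_le_trans b0).
Qed.

End posterior_bounds.

(** * The posterior on the good event *)

Section max_affine_perturbation.
Context (R : realType) (d m : nat).
Implicit Types (theta : m.-tuple (d.-tuple R * R)) (y : 'rV[R]_d).

Lemma affine_dist (p q : d.-tuple R * R) y (delta : R) : cube y ->
  (forall j, `|tnth p.1 j - tnth q.1 j| <= delta) -> `|p.2 - q.2| <= delta ->
  `|affine p y - affine q y| <= d.+1%:R * delta.
Proof.
move=> cy pq1 pq2; rewrite /affine opprD addrACA -sumrB -natr1 mulrDl mul1r.
apply: le_trans (ler_normD _ _) _; apply: lerD => //.
apply: le_trans (ler_norm_sum _ _ _) _.
rewrite mulr_natl -[X in _ *+ X](card_ord d) -sumr_const; apply: ler_sum => j _.
have /andP[y0 y1] := cy j.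
rewrite -mulrBl normrM (ger0_norm y0) -[leRHS]mulr1.
exact: ler_pM.
Qed.

Lemma max_affine_dist theta theta' y (delta : R) : (0 < m)%N -> cube y ->
  (forall i j, `|tnth (tnth theta i).1 j - tnth (tnth theta' i).1 j| <= delta) ->
  (forall i, `|(tnth theta i).2 - (tnth theta' i).2| <= delta) ->
  `|max_affine theta y - max_affine theta' y| <= d.+1%:R * delta.
Proof.
move=> m0 cy h1 h2; pose j0 := Ordinal m0.
have dist i : `|affine (tnth theta i) y - affine (tnth theta' i) y| <= d.+1%:R * delta.
  by apply: affine_dist.
have [[j jE] kP] := max_affineP theta y j0.
have [[j' jE'] kP'] := max_affineP theta' y j0.
rewrite ler_norml; apply/andP; split.
  by have := kP j'; have := dist j'; rewrite jE' ler_norml => /andP[]; lra.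
by have := kP' j; have := dist j; rewrite jE ler_norml => /andP[]; lra.
Qed.

End max_affine_perturbation.

Section sum_norm.
Context (R : realType) (n : nat).
Implicit Types u v : 'rV[R]_n.

Lemma dot_add_le u v : dot (u + v) (u + v) <= 2 * dot u u + 2 * dot v v.
Proof.
have := dot_ge0 (u - v).
rewrite !dotDl !dotDr !dotNl !dotNr (dotC v u); lra.
Qed.

Lemma dot_le_sup u (t : R) : (forall i, `|u 0 i| <= t) -> dot u u <= n%:R * t ^+ 2.
Proof.
move=> ut; rewrite mulr_natl -[X in _ *+ X](card_ord n) -sumr_const; apply: ler_sum => i _.
rewrite -expr2 -(real_normK (num_real (u 0 i))) lerXn2r ?nnegrE//.
exact: le_trans (ut i).
Qed.

End sum_norm.

Section good_event.
Context (R : realType) (d n : nat) (x : 'I_n -> 'rV[R]_d) (f0 : 'rV[R]_d -> R).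
Context (g : R -> R) (lam : nat -> R) (m : nat) (eta : R).
Hypotheses (eta0 : 0 < eta) (d0 : (0 < d)%N) (dn : (d <= n)%N) (n2 : (2 <= n)%N).
Hypotheses (m0 : (0 < m)%N) (xP : forall i, cube (x i)) (gP : prior_density g).

Definition complexity k : R := d%:R * ln n%:R * (k%:R * ln (3 * k)%:R).

Lemma complexity_ge k : (0 < k)%N -> k%:R <= 4 * complexity k.
Proof.
move=> k0; have lh : 2^-1 <= ln n%:R :> R by exact: ln_nat_ge_half.
have l3h : 2^-1 <= ln (3 * k)%:R :> R.
  by apply: ln_nat_ge_half; rewrite (leq_trans (_ : 2 <= 3 * 1)%N)// leq_mul.
have d1 : 1 <= d%:R :> R by rewrite ler1n.
have k1 : 1 <= k%:R :> R by rewrite ler1n.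
rewrite /complexity; set a := ln _ in lh *; set b := ln _ in l3h *.
have ab : 1 <= 4 * (a * b) by nra.
have -> : 4 * (d%:R * a * (k%:R * b)) = k%:R * (d%:R * (4 * (a * b))) by ring.
by rewrite ler_peMr// mulr_ege1.
Qed.

Definition noise_level (E : R) k := 104 * complexity k + 4 * E.

Context (K E : R) (K0 : 0 < K) (E0 : complexity m <= E).
Hypothesis lamE : forall k, (0 < k)%N -> lam k = K * expR (- (108 * complexity k)).
Hypothesis lam1 : (\sum_(1 <= k <oo) (lam k)%:E = 1)%E.
Context (theta0 : m.-tuple (d.-tuple R * R)).
Notation T := (expR (- (ln n%:R * ln (3 * m)%:R / (8 * eta))) / 2).
Hypothesis Ta : forall i, T <= g (sup_norm (tnth theta0 i).1 + 1).
Hypothesis Tb : forall i, T <= g (`|(tnth theta0 i).2| + 1).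
Hypothesis approx : dot (residual x (max_affine theta0) f0)
  (residual x (max_affine theta0) f0) <= E.

Context (e : n.-tuple R).
Hypothesis good : forall k (theta : k.-tuple (d.-tuple R * R)), (0 < k)%N ->
  `|dot (noise_vec e) (residual x (max_affine theta) f0)| <=
  dot (residual x (max_affine theta) f0) (residual x (max_affine theta) f0) / 4 +
  noise_level E k.

Let y := shifted x f0 e.
Let L0 := likelihood x y f0.
Let L00 : 0 < L0. Proof. exact: likelihood_gt0. Qed.
Let lam0 k : (0 < k)%N -> 0 <= lam k.
Proof. by move=> /lamE ->; rewrite mulr_ge0 ?expR_ge0// ltW. Qed.

Let n0 : (0 < n)%N. Proof. exact: ltnW. Qed.

(** The model prior exp(-108 D_k) beats the exp(104 D_k) allowed by the noise,
    and the remaining exp(-4 D_k) is at most 2^-k. *)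
Lemma prior_integral_far (C : R) (A : set ('rV[R]_d -> R)) :
  (forall f, A f -> C * E < dot (residual x f f0) (residual x f f0)) ->
  (prior_integral g lam A (likelihood x y) <= (K * L0 * expR ((4 - C / 4) * E))%:E)%E.
Proof.
move=> far; apply: geometric_half_series => [|k k0].
  by rewrite !mulr_ge0 ?expR_ge0// ltW.
apply/andP; split; first by apply: prior_slice_ge0 => // f; exact/ltW/likelihood_gt0.
pose B := L0 * expR (noise_level E k - C * E / 4).
apply: (@le_trans _ _ ((lam k)%:E * B%:E)%E).
  rewrite lee_wpmul2l ?lee_fin ?lam0//; apply: prior_slice_le => // [|theta /= Atheta].
    by rewrite mulr_ge0 ?expR_ge0// ltW.
  rewrite ltW ?likelihood_gt0//= /y likelihood_ratio ler_wpM2l//; first exact: ltW.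
  rewrite ler_expR; have := good theta k0; rewrite /= ler_norml => /andP[_].
  by have := far _ Atheta; lra.
rewrite -EFinM lee_fin lamE// /B subn1 /=.
have -> : K * expR (- (108 * complexity k)) * (L0 * expR (noise_level E k - C * E / 4)) =
    K * L0 * expR ((4 - C / 4) * E) * expR (- (4 * complexity k)).
  rewrite -!mulrA; congr (_ * _); rewrite mulrCA; congr (_ * _); rewrite -!expRD.
  by congr expR; rewrite /noise_level; field.
rewrite ler_wpM2l//; first by rewrite !mulr_ge0 ?expR_ge0// ltW.
apply: (@le_trans _ _ (expR (- 1) ^+ k)); last first.
  by rewrite lerXn2r ?nnegrE ?expR_ge0// expRN1_le_half.
by rewrite -expRM_natr mulN1r ler_expR lerN2; exact: complexity_ge.
Qed.

Let delta : R := n%:R ^- 2.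

Let delta01 : 0 < delta <= 1.
Proof.
by rewrite /delta invr_gt0 exprn_gt0 ?ltr0n// invf_le1 ?exprn_gt0 ?ltr0n// exprn_ege1// ler1n.
Qed.

(** On the box f stays within (d+1) n^-2 <= 2/n of the minimizer at the design
    points, hence within squared distance 4/n <= 4 <= 16 E; the bound then
    follows from |u+v|^2 <= 2|u|^2 + 2|v|^2. *)
Lemma residual_box theta : away_box theta0 delta theta ->
  dot (residual x (max_affine theta) f0) (residual x (max_affine theta) f0) <= 34 * E.
Proof.
move=> box.
have -> : residual x (max_affine theta) f0 =
    (values_at x (max_affine theta) - values_at x (max_affine theta0)) +
    residual x (max_affine theta0) f0 by rewrite /residual addrA subrK.
apply: le_trans (dot_add_le _ _) _.
have E4 : 1 <= 4 * E.
  have := complexity_ge m0; have : 1 <= m%:R :> R by rewrite ler1n.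
  by move: E0; lra.
suff : dot (values_at x (max_affine theta) - values_at x (max_affine theta0))
  (values_at x (max_affine theta) - values_at x (max_affine theta0)) <= 4.
  by move: approx; lra.
have n1 : 1 <= n%:R :> R by rewrite ler1n.
apply: le_trans (dot_le_sup (t := 2 / n%:R) _) _.
  move=> i; rewrite !mxE; apply: le_trans (_ : d.+1%:R * delta <= _).
    apply: max_affine_dist => // k; last by have [_ /away_interval_near] := box k.
    by move=> j; have [/(_ j)/away_interval_near] := box k.
  rewrite /delta -[_ ^- 2]exprVn expr2 mulrA ler_pM2r ?invr_gt0 ?ltr0n//.
  by rewrite ler_pdivrMr ?ltr0n// -natrM ler_nat mul2n -addnn -addn1 leq_add.
rewrite expr_div_n expr2 [n%:R ^+ 2]expr2 invfM.
have -> : n%:R * (2 * 2 * (n%:R^-1 * n%:R^-1)) = 4 * n%:R^-1 :> R.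
  by field; rewrite gt_eqF// ltr0n.
by rewrite ler_piMr// invf_le1// ltr0n.
Qed.

(** The term of the series at [m], restricted to the box: 108 comes from the
    model prior, 134 from the noise level (at most 108 E) and 3/4 of the 34 E in
    [residual_box], and 12 + 1/(4 eta) from the prior mass of the box. *)
Lemma prior_integral_lower :
  ((K * L0 * expR (- ((254 + 1 / (4 * eta)) * E)))%:E <=
   prior_integral g lam setT (likelihood x y))%E.
Proof.
have lik0 f : 0 <= likelihood x y f by exact/ltW/likelihood_gt0.
have E_ge0 : 0 <= E.
  by apply: le_trans E0; have := complexity_ge m0; have := ler0n R m; lra.
pose B := L0 * expR (- (134 * E)).
have slice : ((B * (T * delta) ^+ (m * d.+1))%:E <=
    \int[@param_lebesgue R d m]_(theta in setT)
      (likelihood x y (max_affine theta) * param_density g theta)%:E)%E.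
  apply: (prior_slice_ge gP (theta0 := theta0)) => //.
  - by rewrite mulr_ge0 ?expR_ge0// ltW.
  move=> theta box; rewrite /B /y likelihood_ratio ler_wpM2l//; first exact: ltW.
  rewrite ler_expR; have := good theta m0; rewrite /= ler_norml => /andP[+ _].
  have := residual_box box; move: E0; rewrite /noise_level; lra.
apply: (@le_trans _ _ ((lam m)%:E * (B * (T * delta) ^+ (m * d.+1))%:E)%E); last first.
  apply: le_trans (nneseries_ge_term (N := 1%N) _ m0); last first.
    by move=> k k0; exact: prior_slice_ge0.
  by rewrite preimage_setT lee_wpmul2l ?lee_fin ?lam0.
rewrite -EFinM lee_fin lamE//.
have ball := small_ball_bound eta0 n2 d0 m0; rewrite -/(complexity m) in ball.
have eta_ge0 : 0 <= 12 + 1 / (4 * eta) by rewrite addr_ge0// divr_ge0 ?mulr_ge0// ltW.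
apply: (@le_trans _ _ (K * expR (- (108 * complexity m)) *
    (B * expR (- ((12 + 1 / (4 * eta)) * complexity m))))); last first.
  apply: ler_wpM2l; first by rewrite mulr_ge0 ?expR_ge0// ltW.
  by apply: ler_wpM2l => //; rewrite mulr_ge0 ?expR_ge0// ltW.
rewrite /B -!mulrA; rewrite ler_wpM2l ?(ltW K0)// [leRHS]mulrCA ler_wpM2l ?(ltW L00)//.
rewrite -!expRD ler_expR.
have := ler_wpM2l eta_ge0 E0; move: E0; lra.
Qed.

(** 1036 + 1/eta = 4 (4 + 254 + 1/(4 eta) + 1). *)
Lemma posterior_far (A : set ('rV[R]_d -> R)) :
  (forall f, A f ->
     (1036 + 1 / eta) * E < dot (residual x f f0) (residual x f f0)) ->
  posterior x g lam A y <= expR (- E).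
Proof.
move=> /prior_integral_far num; have b0 : 0 < K * L0 * expR (- ((254 + 1 / (4 * eta)) * E)).
  by rewrite !mulr_gt0 ?expR_gt0.
apply: le_trans (posterior_le_ratio gP lam0 lam1 b0 num prior_integral_lower) _.
rewrite ler_pdivrMr// [leRHS]mulrCA.
apply: ler_wpM2l; first by rewrite mulr_ge0 ?ltW.
rewrite -expRD ler_expR le_eqVlt; apply/orP; left; apply/eqP; field.
by rewrite gt_eqF.
Qed.

End good_event.

(** * The bad event *)

Section bad_event.
Context (R : realType) (d n : nat) (E : R) (S : nat -> seq (seq 'rV[R]_n)).
Hypotheses (d0 : (0 < d)%N) (n2 : (2 <= n)%N).
Hypothesis sizeS : forall k, (0 < k)%N ->
  (size (S k) <= (n * (k * k)).+1 ^ (k * d.+1))%N.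
Hypothesis SP : forall k, (0 < k)%N ->
  {in S k, forall us, orthonormal_seq us /\ (size us <= (k * d.+1).+1)%N}.
Local Open Scope ereal_scope.
Notation noise := (measure_power (normal_prob (0 : R) 1) n).

(** Instead of an event, a measurable function that is at least 1 as soon as
    some projection exceeds its noise level: the exponential Markov bounds of
    all projections, summed. *)
Definition exceedance (e : n.-tuple R) : \bar R :=
  \sum_(0 <= k <oo) \sum_(us <- S k.+1)
    (expR ((proj_sq us (noise_vec e) - noise_level d n E k.+1) / 4))%:E.

Let term k us (e : n.-tuple (measurableTypeR R)) : \bar R :=
  (expR ((proj_sq us (noise_vec e) - noise_level d n E k.+1) / 4))%:E.

Let mterm k us : measurable_fun setT (term k us).
Proof.
apply/measurable_EFinP; apply: measurableT_comp => //; apply: measurable_funM => //.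
by apply: measurable_funB => //; exact: measurable_proj_sq_noise.
Qed.

Let mlevel k : measurable_fun setT (fun e => \sum_(us <- S k.+1) term k us e).
Proof. by apply: emeasurable_sum. Qed.

Lemma exceedance_ge0 e : 0 <= exceedance e.
Proof. by apply: nneseries_ge0 => k _ _; apply: sume_ge0 => us _; rewrite lee_fin expR_ge0. Qed.

Lemma measurable_exceedance :
  measurable_fun [set: n.-tuple (measurableTypeR R)] exceedance.
Proof.
apply: ge0_emeasurable_sum => // k e _ _.
by apply: sume_ge0 => us _; rewrite lee_fin expR_ge0.
Qed.

(** By [count_bound] the families of level k contribute at most
    exp(22 D_k - (104 D_k + 4 E)/4) = exp(-4 D_k - E), and D_k >= k/4 makes the
    sum over k converge geometrically. *)
Lemma integral_exceedance : \int[noise]_e exceedance e <= (expR (- E))%:E.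
Proof.
rewrite integral_nneseries//; last first.
  by move=> k e _; apply: sume_ge0 => us _; rewrite lee_fin expR_ge0.
apply: geometric_half_series => [|k _]; first exact: expR_ge0.
apply/andP; split.
  by apply: integral_ge0 => e _; apply: sume_ge0 => us _; rewrite lee_fin expR_ge0.
rewrite ge0_integral_sum//.
pose c := (Num.sqrt (2 : R) ^+ (k.+1 * d.+1).+1 * expR (- (noise_level d n E k.+1 / 4)))%R.
have c0 : (0 <= c)%R by rewrite mulr_ge0 ?exprn_ge0 ?sqrtr_ge0 ?expR_ge0.
apply: (@le_trans _ _ (\sum_(us <- S k.+1) c%:E)).
  rewrite big_seq_cond [leRHS]big_seq_cond; apply: lee_sum => us /andP[usS _].
  have [ous szus] := SP (ltn0Sn k) usS.
  have -> : \int[noise]_e (term k us e) =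
      \int[noise]_e ((expR (- (noise_level d n E k.+1 / 4)))%:E *
        (expR (proj_sq us (noise_vec e) / 4))%:E).
    by apply: eq_integral => e _; rewrite -EFinM -expRD; congr (expR _)%:E; field.
  rewrite ge0_integralZl//; last first.
    apply/measurable_EFinP; apply: measurableT_comp => //; apply: measurable_funM => //.
    exact: measurable_proj_sq_noise.
  rewrite noise_projection_tail_mgf// -EFinM lee_fin mulrC ler_wpM2r ?expR_ge0//.
  by rewrite ler_weXn2l//; case/andP: (sqrt2_bounds R).
rewrite sumEFin lee_fin big_const_seq count_predT iter_addr_0.
apply: (@le_trans _ _ (((n * (k.+1 * k.+1)).+1 ^ (k.+1 * d.+1))%:R * c)%R).
  by rewrite mulr_natl; apply: ler_wpMn2l => //; exact: sizeS.
have h22 := @count_bound R d n k.+1 n2 d0 (ltn0Sn k).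
rewrite -/(complexity R d n k.+1) in h22.
rewrite /c mulrA; apply: le_trans (ler_wpM2r (expR_ge0 _) h22) _.
rewrite -expRD subn0.
apply: (@le_trans _ _ (expR (- E) * expR (- 1) ^+ k.+1)%R); last first.
  by rewrite ler_wpM2l ?expR_ge0// lerXn2r ?nnegrE ?expR_ge0// expRN1_le_half.
rewrite -expRM_natr -expRD ler_expR /noise_level.
have := @complexity_ge R d n d0 n2 k.+1 (ltn0Sn k); lra.
by move=> us; exact: mterm.
Qed.

Lemma exceedance_ge1 e k us : (0 < k)%N -> us \in S k ->
  (noise_level d n E k < proj_sq us (noise_vec e))%R -> 1 <= exceedance e.
Proof.
case: k => // k _ usS lt_us.
have t0 vs : 0 <= term k vs e by rewrite lee_fin expR_ge0.
apply: (@le_trans _ _ (term k us e)).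
  by rewrite lee_fin -[leLHS]expR0 ler_expR divr_ge0// subr_ge0 ltW.
apply: (@le_trans _ _ (\sum_(vs <- S k.+1) term k vs e)).
  by rewrite (big_rem us)//= leeDl// sume_ge0.
apply: (nneseries_ge_term (u := fun k => \sum_(vs <- S k.+1) term k vs e)) => // j _.
by apply: sume_ge0 => vs _; rewrite lee_fin expR_ge0.
Qed.

End bad_event.

(** * Use of the hypotheses, and the theorem *)

Section hypotheses.
Context (R : realType) (d n : nat) (x : 'I_n -> 'rV[R]_d).

(** The supremum in tau need not be attained; half of it is exceeded by some
    minimizer. *)
Lemma tau_cvx_minimizer m (g : R -> R) (f0 : 'rV[R]_d -> R) (T : R) : 0 < T ->
  (T%:E <= tau_cvx x m g f0)%E ->
  exists theta : m.-tuple (d.-tuple R * R),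
    [/\ argmin_class x m f0 (max_affine theta),
        forall i, T / 2 <= g (sup_norm (tnth theta i).1 + 1) &
        forall i, T / 2 <= g (`|(tnth theta i).2| + 1)].
Proof.
move=> T0 Ttau; have : ((T / 2)%:E < tau_cvx x m g f0)%E.
  by apply: lt_le_trans Ttau; rewrite lte_fin; lra.
move=> /ereal_sup_gt[_ [theta min_theta <-]] /ltW T2.
have le_i i : ((T / 2)%:E <= mine (g (sup_norm (tnth theta i).1 + 1))%:E
                        (g (`|(tnth theta i).2| + 1))%:E)%E.
  by apply: le_trans T2 _; exact: bigmin_le.
exists theta; split => // i; have := le_i i; rewrite le_min !lee_fin => /andP[] //.
Qed.

Lemma argmin_eps2 m (f0 : 'rV[R]_d -> R) theta :
  argmin_class x m f0 (max_affine theta) ->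
  ell2 x f0 (@max_affine R d m theta) <= eps2_cvx x m f0.
Proof.
move=> [_ minP]; rewrite /eps2_cvx le_max; apply/orP; left.
apply: lb_le_inf.
  by exists (ell2 x f0 (max_affine theta)), (max_affine theta) => //; exists theta.
by move=> _ [h hclass <-]; exact: minP.
Qed.

(** For n = 1 the weights are constant and cannot sum to 1. *)
Lemma selection_prior_n2 (c : R) lam : (0 < n)%N -> selection_prior c d n lam -> (2 <= n)%N.
Proof.
case: n => [//|[|//]] _ [[K K0 lamE] lam1]; exfalso.
have lamK k : (0 < k)%N -> lam k = K.
  by move=> k0; rewrite lamE// ln1 mulr0 oppr0 expR0 mulr1.
have partial k : k%:R * K <= 1.
  rewrite -lee_fin -lam1.
  apply: le_trans (nneseries_ge_partial k.+1 _); last first.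
    by move=> j j0; rewrite lee_fin lamK// ltW.
  rewrite sumEFin lee_fin (eq_big_nat _ _ (F2 := fun=> K)); last first.
    by move=> j /andP[j0 _]; exact: lamK.
  by rewrite big_const_nat iter_addr_0 subn1 mulr_natl.
have := partial (Num.truncn K^-1).+1; apply/negP; rewrite -ltNge.
by rewrite -ltr_pdivrMr// mul1r truncnS_gt.
Qed.

End hypotheses.

Theorem theorem3p10 (R : realType) (eta : R) (heta : 0 < eta < 1 / 4) :
  exists c C1 C2 : R, [/\ 0 < c, 0 < C1, 0 < C2 &
    forall (d n : nat) (x : 'I_n -> 'rV[R]_d) (f0 : 'rV[R]_d -> R)
           (g : R -> R) (lam : nat -> R) (m : nat),
      (0 < d)%N -> (d <= n)%N -> (0 < m)%N ->
      (forall i, cube (x i)) ->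
      prior_density g ->
      selection_prior c d n lam ->
      ((expR (- (ln n%:R * ln (3 * m)%:R / (8 * eta))))%:E
         <= tau_cvx x m g f0)%E ->
      (expect_under x f0
         (posterior x g lam
            [set f | convex_class f /\ (C1 * eps2_cvx x m f0 < ell2 x f f0)%R])
       <= (C2 * expR (- (n%:R * eps2_cvx x m f0 / C2)))%:E)%E].
Proof.
have eta0 : 0 < eta by case/andP: heta.
have C10 : 0 < 1036 + 1 / eta by apply: addr_gt0; [rewrite ltr0n|exact: divr_gt0].
exists 108, (1036 + 1 / eta), 2.
split; [by rewrite ltr0n|exact: C10|by rewrite ltr0n|] => d n x f0 g lam m d0 dn m0 xP gP lamP.
have n0 : (0 < n)%N by exact: leq_trans d0 dn.
have n2 := selection_prior_n2 n0 lamP.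
have nR0 : 0 < n%:R :> R by rewrite ltr0n.
move=> /tau_cvx_minimizer[|theta0 [/argmin_eps2 min0 Ta Tb]]; first exact: expR_gt0.
have [[K K0 lamE] lam1] := lamP.
set E := n%:R * eps2_cvx x m f0.
have lamE' k : (0 < k)%N -> lam k = K * expR (- (108 * complexity R d n k)).
  by move=> k0; rewrite lamE// /complexity; congr (_ * expR (- _)); ring.
have E0 : complexity R d n m <= E.
  rewrite /E mulrC -ler_pdivrMr//.
  by rewrite /eps2_cvx le_max lexx orbT.
have approx : dot (residual x (max_affine theta0) f0)
    (residual x (max_affine theta0) f0) <= E.
  rewrite /E mulrC -ler_pdivrMr// mulrC -ell2E.
  apply: le_trans min0; rewrite /ell2 le_eqVlt; apply/orP; left; apply/eqP.
  by congr (_ * _); apply: eq_bigr => i _; rewrite -sqrrN opprB.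
have lam0 k : (0 < k)%N -> 0 <= lam k.
  by move=> /lamE' ->; rewrite mulr_ge0 ?expR_ge0// ltW.
have /choice[S SP] : forall k, exists S : seq (seq 'rV[R]_n), (0 < k)%N ->
    [/\ (size S <= (n * (k * k)).+1 ^ (k * d.+1))%N,
      {in S, forall us, orthonormal_seq us /\ (size us <= (k * d.+1).+1)%N} &
      forall theta : k.-tuple (d.-tuple R * R), exists2 us, us \in S &
        expands us (residual x (max_affine theta) f0)].
  case=> [|k]; first by exists [::].
  by have [S SP] := residual_cover x f0 (ltn0Sn k); exists S.
set A := [set f | _].
have pointwise (e : n.-tuple R) :
    ((posterior x g lam A (shifted x f0 e))%:E <= exceedance d E S e + (expR (- E))%:E)%E.
  have [good|] := pselect (forall k us, (0 < k)%N -> us \in S k ->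
      proj_sq us (noise_vec e) <= noise_level d n E k).
    apply: le_trans (leeDr _ (exceedance_ge0 d E S e)).
    rewrite lee_fin; apply: (posterior_far eta0 d0 dn n2 m0 xP gP K0 E0 lamE' lam1
      Ta Tb approx) => [k theta k0|f [_ far]].
      have [_ _ /(_ theta)[us usS hE]] := SP k k0.
      apply: le_trans (normr_dot_expands (noise_vec e) hE) _.
      by rewrite lerD2l good.
    by move: far; rewrite ell2E ltr_pdivlMl// mulrCA.
  move=> bad; apply: le_trans (leeDl _ _); last by rewrite lee_fin expR_ge0.
  apply: (@le_trans _ _ 1%E); first by rewrite lee_fin posterior_le1.
  apply: contrapT => exc; apply: bad => k us k0 usS.
  by rewrite leNgt; apply/negP => lt_us; apply: exc; exact: exceedance_ge1 lt_us.
have SP' k : (0 < k)%N -> (size (S k) <= (n * (k * k)).+1 ^ (k * d.+1))%N by case/SP.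
have SP'' k : (0 < k)%N -> {in S k, forall us,
    orthonormal_seq us /\ (size us <= (k * d.+1).+1)%N} by case/SP.
apply: (@le_trans _ _ (\int[measure_power (normal_prob (0 : R) 1) n]_e
    (exceedance d E S e + (expR (- E))%:E))%E).
  apply: ge0_le_integral_nonmeasurable => e; last 1 first.
  - by move=> _; exact: pointwise.
  - by move=> _; rewrite lee_fin posterior_ge0.
  - by rewrite adde_ge0 ?exceedance_ge0// lee_fin expR_ge0.
rewrite ge0_integralD//; last 2 first.
- by move=> e _; exact: exceedance_ge0.
- exact: measurable_exceedance.
have -> : (\int[measure_power (normal_prob (0 : R) 1) n]_e (expR (- E))%:E =
    (expR (- E))%:E)%E.
  have := noise_mgf (0 : 'rV[R]_n); rewrite dot0l mul0r expR0 => total.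
  rewrite -[RHS]mule1 -total -ge0_integralZl//.
    apply: eq_integral => e _; rewrite dotC dot0l expR0 mule1 //.
  by under eq_fun do rewrite dotC dot0l; exact: measurable_cst.
apply: le_trans (leeD (integral_exceedance E d0 n2 SP' SP'') (lexx _)) _.
have E_ge0 : 0 <= E.
  by apply: le_trans E0; have := complexity_ge R d0 n2 m0; have := ler0n R m; lra.
have : expR (- E) <= expR (- (E / 2)) by rewrite ler_expR; lra.
by rewrite -EFinD lee_fin; lra.
Qed.
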